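(* Consider the Clipped FedSMD algorithm described in the context, run for iterations $t=1,2,\dots$, under Assumptions (A1)–(A3). Fix $\delta\in(0,1)$, $p\in(1,2]$ and $\sigma$ from (A1), $0<\kappa<1$, $0<\mu<1$ with $\kappa\ge\max\{\mu+\frac12,1-\mu(p-1)\}$, and $\gamma>1$. Let $A>0$ and $$\alpha_t=\frac{1}{(1+\log t)^\gamma t^{\kappa-\mu}}\min\Big\{\frac1{t^\mu},\big[2mL(2R_1+10A)+2B\big]^{-1}\Big\},\qquad\lambda_t=\max\big\{t^\mu,2mL(2R_1+10A)+2B\big\},$$ where $A=\log\frac1\delta+mL\mathcal P^2C_0+2m\mathcal PC_1+4\sigma^pC_2+16m\sigma^{2p}C_3+40m\sigma^p(1+3m)C_4+40m^2\sigma^pC_5+8m$ with $C_0=\sum_{t\ge1}\alpha_t\alpha_{\tau(t)}^2\lambda_{\tau(t)}^2$, $C_1=\sum_{t\ge1}\alpha_t\alpha_{\tau(t)}\lambda_t\lambda_{\tau(t)}$, $C_2=\sum_{t\ge1}\alpha_t\lambda_t^{1-p}$, $C_3=\sum_{t\ge1}\alpha_t^2\lambda_t^{2-2p}$, $C_4=\sum_{t\ge1}(\alpha_t\lambda_t)^2\lambda_t^{-p}$, $C_5=\sum_{t\ge1}(\alpha_t\lambda_t)^4\lambda_t^{-p}$. Then for any agent $\ell\in[m]$, with probability at least $1-\delta$, for any $T\in\mathbb N$, $$f(\widehat x^T_\ell)-f(x^* )\le\frac{1}{T\alpha_T}\,m^2(R_1+10A)^2,\qquad\text{where }\widehat x^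T_\ell=\frac1T\sum_{t=1}^Tx_{\ell,t}.$$
   Context: Setting: $m,n\in\mathbb N$, $\|\cdot\|$ Euclidean norm on $\mathbb R^n$, $\mathcal X\subset\mathbb R^n$ nonempty closed convex, $f_i:\mathcal X\to\mathbb R$ convex differentiable ($i\in[m]$), $f=\sum_if_i$, $x^*\in\mathcal X$ a minimizer of $f$. $\Phi:\mathcal X\to\mathbb R$ differentiable, $1$-strongly convex ($\Phi(x)-\Phi(y)\ge\langle\nabla\Phi(y),x-y\rangle+\frac12\|x-y\|^2$), $D_\Phi(x\|y)=\Phi(x)-\Phi(y)-\langle\nabla\Phi(y),x-y\rangle$. Agent $i$ queried at $x$ receives a random $\widehat\nabla f_i(x)$; $\widetilde\nabla_\lambda f_i(x)=\min\{1,\lambda/\|\widehat\nabla f_i(x)\|\}\widehat\nabla f_i(x)$. Clipped FedSMD: communication period $\mathcal P\in\mathbb N$, communication instants $\{1+k\mathcal P:k\ge1\}$. From $x_{i,1}\in\mathcal X$, for each $t\ge1$ each agent $i$ sets $y_{i,t+1}=\arg\min_{x\in\mathcal X}\{\langle\widetilde\nabla_{\lambda_t}f_i(x_{i,t}),x\rangle+\frac1{\alpha_t}D_\Phi(x\|x_{i,t})\}$, and $x_{i,t+1}=\frac1m\sum_jy_{j,t+1}$ if $t+1$ is a communication instant, else $x_{i,t+1}=y_{i,t+1}$. $\tau(t)=\max\{1+k\mathcal P:k\ge1,1+k\mathcal P\le t\}$ if $t>1+\mathcal P$, $\tau(t)=1$ if $1\le t\le1+\mathcal P$. $\mathcal F_t$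 is the $\sigma$-algebra generated by $\{\widehat\nabla f_i(x_{i,s}):i\in[m],s\le t\}$, $\mathcal F_0$ trivial. Assumptions: (A1) $\mathbb E[\widehat\nabla f_i(x_{i,t})\mid\mathcal F_{t-1}]=\nabla f_i(x_{i,t})$ and $\mathbb E[\|\widehat\nabla f_i(x_{i,t})-\nabla f_i(x_{i,t})\|^p\mid\mathcal F_{t-1}]\le\sigma^p$, $\sigma>0$, $p\in(1,2]$; (A2) $\|\nabla f_i(x)-\nabla f_i(y)\|\le L\|x-y\|$ on $\mathcal X$; (A3) $D_\Phi(x\|\sum_ja_jy_j)\le\sum_ja_jD_\Phi(x\|y_j)$ for all $x,y_j\in\mathcal X$, $a_j\ge0$, $\sum_ja_j=1$. $R_1=\max_{i\in[m]}\sqrt{2D_\Phi(x^*\|x_{i,1})}$ (or a known upper bound of it), $B=\max_{i\in[m]}\|\nabla f_i(x_{i,1})\|$. *)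

(* Defs.v *)
From mathcomp Require Import all_boot all_order all_algebra.
From mathcomp Require Import all_classical all_reals all_analysis.
Set Implicit Arguments. Unset Strict Implicit. Unset Printing Implicit Defensive.
Import Order.TTheory GRing.Theory Num.Theory.
Import numFieldNormedType.Exports.
Local Open Scope ring_scope.
Local Open Scope classical_set_scope.

Definition dotv (R : realType) (n : nat) (u v : 'rV[R]_n) : R :=
  \sum_(k < n) u 0 k * v 0 k.
Definition enorm (R : realType) (n : nat) (u : 'rV[R]_n) : R :=
  Num.sqrt (dotv u u).

Definition has_gradient_at (R : realType) (n : nat) (g : 'rV[R]_n -> R)
  (dg : 'rV[R]_n -> 'rV[R]_n) (z : 'rV[R]_n) : Prop :=
  differentiable g z /\ forall v, 'd g z v = dotv (dg z) v.

Definition bregman (R : realType) (n : nat) (Phi : 'rV[R]_n -> R)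
  (gradPhi : 'rV[R]_n -> 'rV[R]_n) (u v : 'rV[R]_n) : R :=
  Phi u - Phi v - dotv (gradPhi v) (u - v).

Definition clip (R : realType) (n : nat) (lam : R) (g : 'rV[R]_n) : 'rV[R]_n :=
  Num.min 1 (lam / enorm g) *: g.

Definition comm_instant (Pc s : nat) : Prop :=
  exists k, (1 <= k)%N /\ s = (1 + k * Pc)%N.

Definition tau (Pc t : nat) : nat :=
  if (1 + Pc < t)%N then
    \max_(k < t.+1 | (1 <= k)%N && (1 + k * Pc <= t)%N) (1 + k * Pc)%N
  else 1%N.

Definition Bconst (R : realType) (m n : nat)
  (gradf : 'I_m -> 'rV[R]_n -> 'rV[R]_n) (x1 : 'I_m -> 'rV[R]_n) : R :=
  \big[Num.max/0]_(i < m) enorm (gradf i (x1 i)).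

Definition Kconst (R : realType) (m : nat) (L R1 A B : R) : R :=
  2 * m%:R * L * (2 * R1 + 10 * A) + 2 * B.

Definition alpha (R : realType) (gamma kappa mu K : R) (t : nat) : R :=
  ((1 + ln (t%:R)) `^ gamma * (t%:R) `^ (kappa - mu))^-1 *
  Num.min ((t%:R `^ mu)^-1) K^-1.

Definition lambda (R : realType) (mu K : R) (t : nat) : R :=
  Num.max (t%:R `^ mu) K.

Definition series1 (R : realType) (c : nat -> R) : \bar R :=
  (\sum_(1 <= t <oo) (c t)%:E)%E.

Definition Aexpr (R : realType) (m Pc : nat) (L delta sigma p : R)
  (al la : nat -> R) : \bar R :=
  let C0 := series1 (fun t => al t * (al (tau Pc t)) ^+ 2 * (la (tau Pc t)) ^+ 2) in
  let C1 := series1 (fun t => al t * al (tau Pc t) * la t * la (tau Pc t)) in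
  let C2 := series1 (fun t => al t * la t `^ (1 - p)) in
  let C3 := series1 (fun t => (al t) ^+ 2 * la t `^ (2 - 2 * p)) in
  let C4 := series1 (fun t => (al t * la t) ^+ 2 * la t `^ (- p)) in
  let C5 := series1 (fun t => (al t * la t) ^+ 4 * la t `^ (- p)) in
  ((ln (delta^-1))%:E
   + (m%:R * L * (Pc%:R) ^+ 2)%:E * C0
   + (2 * m%:R * Pc%:R)%:E * C1
   + (4 * sigma `^ p)%:E * C2
   + (16 * m%:R * sigma `^ (2 * p))%:E * C3
   + (40 * m%:R * sigma `^ p * (1 + 3 * m%:R))%:E * C4
   + (40 * (m%:R) ^+ 2 * sigma `^ p)%:E * C5
   + (8 * m%:R)%:E)%E.

(* Generators of F_t: preimages of Borel sets under the coordinates of the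
   stochastic gradients hat(grad) f_i(x_{i,s}), i in [m], 1 <= s <= t. *)
Definition Fgen (R : realType) (m n : nat) (d : measure_display)
  (Omega : measurableType d) (ghat : 'I_m -> nat -> Omega -> 'rV[R]_n)
  (t : nat) : set (set Omega) :=
  [set S | exists (i : 'I_m) (s : nat) (k : 'I_n) (Bs : set R),
     [/\ (1 <= s <= t)%N, measurable Bs &
         S = (fun w => ghat i s w 0 k) @^-1` Bs]].

(* F_t : the sigma-algebra generated (F_0 is the trivial one). *)
Definition Fsig (R : realType) (m n : nat) (d : measure_display)
  (Omega : measurableType d) (ghat : 'I_m -> nat -> Omega -> 'rV[R]_n)
  (t : nat) : set (set Omega) :=
  <<s Fgen ghat t >>.

Definition xavg (R : realType) (n : nat) (xl : nat -> 'rV[R]_n) (T : nat)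
  : 'rV[R]_n :=
  (T%:R)^-1 *: \sum_(1 <= t < T.+1) xl t.

(* Main.v *)
Require Import Defs.
From mathcomp Require Import all_boot all_order all_algebra.
From mathcomp Require Import all_classical all_reals all_analysis.
From mathcomp Require Import measurable_realfun zify ring lra.
Set Implicit Arguments.
Unset Strict Implicit.
Import Order.TTheory GRing.Theory Num.Theory.
Import numFieldNormedType.Exports.
Local Open Scope ring_scope.
Local Open Scope classical_set_scope.

(** Write [G = m (R1 + 10 A)] and let [S_t] be the sum over the agents of
    [D_Phi (xstar || x_(i,t))]. The mirror step, (A3) at communication instants and convexity
    give [S_(t+1) + alpha_t (f (x_(l,t)) - f xstar) <= S_t + noise_t + error_t], where the error
    comes from the squared step lengths [(alpha_t lambda_t)^2] and from the distance between
    agents since their last communication. As long as [2 S_t <= G^2], every iterate is within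
    [G] of [xstar], its gradients are at most [lambda_t / 2], and the noise can be replaced by
    its truncation to the ball of radius [G] around [xstar]. The truncated noise is controlled
    for all times at once by Ville's inequality: [expR (<clip (g + z) - g, b>)] is bounded
    pointwise by [1 + <z, b> + c |z|^p], so no conditional expectation of the clipped gradient
    is needed. The resulting total is below [G^2 / 2], which closes the induction. *)

(** * Euclidean vectors and clipping *)

(** (A1) is available only through integrals over sets of [F_(t-1)], so every weight put on a noise
    term must be bounded and measurable for that sigma-algebra. Boundedness comes from the
    truncation: it is decided by [x_(i,t)] alone, so the noise is controlled before anything is
    known about the size of the iterates, and on the good event the induction shows that the
    truncation never acts. Measurability has to be extracted from the minimization property of
    [y_(i,t+1)], as continuity of [gradPhi] on [X] is not assumed. The gradient bound [lambda_t / 2]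
    leaves a margin: a sample that gets clipped deviates from its mean by more than [lambda_t / 2],
    and such deviations are paid for by the [p]-th moment. Agents of one round may be dependent
    given the past, so their noises are summed before exponentiating, at the cost of a factor [m] in
    the quadratic term. Before the first averaging the agents are only as close as their starting
    points; this error is absorbed because [2 m Pc <= A]. *)

Section euclidean_vectors.
Context {R : realType} {n : nat}.
Implicit Types (u v w : 'rV[R]_n) (a : R).

Lemma dotvC u v : dotv u v = dotv v u.
Proof. by apply: eq_bigr => k _; rewrite mulrC. Qed.

Lemma dotvDl u v w : dotv (u + v) w = dotv u w + dotv v w.
Proof. by rewrite -big_split; apply: eq_bigr => k _; rewrite mxE mulrDl. Qed.

Lemma dotvZl a u v : dotv (a *: u) v = a * dotv u v.
Proof. by rewrite mulr_sumr; apply: eq_bigr => k _; rewrite mxE mulrA. Qed.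

Lemma dotvNl u v : dotv (- u) v = - dotv u v.
Proof. by rewrite -scaleN1r dotvZl mulN1r. Qed.

Lemma dotvBl u v w : dotv (u - v) w = dotv u w - dotv v w.
Proof. by rewrite dotvDl dotvNl. Qed.

Lemma dotvDr u v w : dotv u (v + w) = dotv u v + dotv u w.
Proof. by rewrite dotvC dotvDl !(dotvC u). Qed.

Lemma dotvZr a u v : dotv u (a *: v) = a * dotv u v.
Proof. by rewrite dotvC dotvZl dotvC. Qed.

Lemma dotvNr u v : dotv u (- v) = - dotv u v.
Proof. by rewrite dotvC dotvNl dotvC. Qed.

Lemma dotvBr u v w : dotv u (v - w) = dotv u v - dotv u w.
Proof. by rewrite dotvDr dotvNr. Qed.

Lemma dotv0l v : dotv 0 v = 0.
Proof. by rewrite -(scale0r v) dotvZl mul0r. Qed.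

Lemma dotv0r v : dotv v 0 = 0.
Proof. by rewrite dotvC dotv0l. Qed.

Lemma dotv_sumr (I : Type) (s : seq I) (P : pred I) u (F : I -> 'rV[R]_n) :
  dotv u (\sum_(i <- s | P i) F i) = \sum_(i <- s | P i) dotv u (F i).
Proof. by elim/big_rec2 : _ => [|i a v _ <-]; rewrite (dotv0r, dotvDr). Qed.

Lemma dotvv_ge0 u : 0 <= dotv u u.
Proof. by apply: sumr_ge0 => k _; rewrite -expr2 sqr_ge0. Qed.

Lemma enorm_ge0 u : 0 <= enorm u.
Proof. exact: sqrtr_ge0. Qed.

Lemma sqr_enorm u : enorm u ^+ 2 = dotv u u.
Proof. by rewrite sqr_sqrtr ?dotvv_ge0. Qed.

Lemma enorm0 : enorm (0 : 'rV[R]_n) = 0.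
Proof. by rewrite /enorm dotv0l sqrtr0. Qed.

Lemma enormZ a u : enorm (a *: u) = `|a| * enorm u.
Proof.
by rewrite /enorm dotvZl dotvZr mulrA -expr2 sqrtrM ?sqr_ge0// sqrtr_sqr.
Qed.

Lemma enormN u : enorm (- u) = enorm u.
Proof. by rewrite -scaleN1r enormZ normrN1 mul1r. Qed.

Lemma enormBC u v : enorm (u - v) = enorm (v - u).
Proof. by rewrite -enormN opprB. Qed.

Lemma coord_le_enorm u k : `|u 0 k| <= enorm u.
Proof.
rewrite -(ler_pXn2r (ltn0Sn 1)) ?nnegrE ?enorm_ge0// sqr_enorm -normrX.
rewrite ger0_norm ?sqr_ge0// /dotv (bigD1 k)//= -expr2 lerDl.
by apply: sumr_ge0 => j _; rewrite -expr2 sqr_ge0.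
Qed.

Lemma enorm_eq0 u : enorm u = 0 -> u = 0.
Proof.
move=> u0; apply/rowP => k; rewrite mxE; apply/eqP; rewrite -normr_eq0.
by rewrite eq_le normr_ge0 andbT -u0 coord_le_enorm.
Qed.

Lemma dotv_le u v : dotv u v <= enorm u * enorm v.
Proof.
have [/enorm_eq0 ->|u0] := eqVneq (enorm u) 0; first by rewrite dotv0l enorm0 mul0r.
have [/enorm_eq0 ->|v0] := eqVneq (enorm v) 0; first by rewrite dotv0r enorm0 mulr0.
have := dotvv_ge0 (enorm v *: u - enorm u *: v).
rewrite dotvBl !dotvBr !dotvZl !dotvZr -!sqr_enorm (dotvC v u).
have pu : 0 < enorm u by rewrite lt_def u0 enorm_ge0.
have pv : 0 < enorm v by rewrite lt_def v0 enorm_ge0.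
move=> H; have : 0 <= 2 * (enorm u * enorm v) * (enorm u * enorm v - dotv u v).
  by apply: le_trans H _; rewrite le_eqVlt; apply/orP; left; apply/eqP; ring.
by rewrite pmulr_rge0 ?subr_ge0// !mulr_gt0.
Qed.

Lemma norm_dotv_le u v : `|dotv u v| <= enorm u * enorm v.
Proof.
by rewrite ler_norml dotv_le andbT lerNl -dotvNl -(enormN u) dotv_le.
Qed.

Lemma enormD u v : enorm (u + v) <= enorm u + enorm v.
Proof.
rewrite -(ler_pXn2r (ltn0Sn 1)) ?nnegrE ?addr_ge0 ?enorm_ge0//.
rewrite sqr_enorm dotvDl !dotvDr -!sqr_enorm sqrrD (dotvC v u).
have := dotv_le u v; lra.
Qed.

Lemma enormB u v : enorm (u - v) <= enorm u + enorm v.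
Proof. by rewrite -(enormN v) enormD. Qed.

Lemma enorm_dist v u w : enorm (u - w) <= enorm (u - v) + enorm (v - w).
Proof. by rewrite -[u - w](subrKA v) enormD. Qed.

Lemma enorm_le_sum u : enorm u <= \sum_k `|u 0 k|.
Proof.
rewrite -(ler_pXn2r (ltn0Sn 1)) ?nnegrE ?enorm_ge0 ?sumr_ge0// sqr_enorm.
rewrite expr2 mulr_suml; apply: ler_sum => k _.
apply: (@le_trans _ _ (`|u 0 k| * `|u 0 k|)); first by rewrite -normrM ler_norm.
rewrite ler_wpM2l// (bigD1 k)//= lerDl sumr_ge0//.
Qed.

End euclidean_vectors.

(** * Clipping: bias and second moment *)

Section clipping.
Context {R : realType} {n : nat}.
Implicit Types (g z h : 'rV[R]_n) (lam p : R).

Lemma clip_id lam h : enorm h <= lam -> clip lam h = h.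
Proof.
move=> hl; have [/enorm_eq0 ->|h0] := eqVneq (enorm h) 0.
  by rewrite /clip scaler0.
have ph : 0 < enorm h by rewrite lt_def h0 enorm_ge0.
by rewrite /clip min_l ?scale1r// ler_pdivlMr// mul1r.
Qed.

Lemma clip_big lam h : 0 <= lam -> lam < enorm h -> clip lam h = (lam / enorm h) *: h.
Proof.
move=> l0 hl; rewrite /clip min_r// ler_pdivrMr ?mul1r 1?ltW//.
exact: le_lt_trans hl.
Qed.

Lemma enorm_clip lam h : 0 <= lam -> enorm (clip lam h) <= lam.
Proof.
move=> l0; have [hl|hl] := leP (enorm h) lam; first by rewrite clip_id.
have ph := le_lt_trans l0 hl.
by rewrite clip_big// enormZ ger0_norm ?divr_ge0 ?enorm_ge0// divfK// gt_eqF.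
Qed.

Lemma enorm_clipB lam h : 0 <= lam -> enorm (h - clip lam h) <= Num.max 0 (enorm h - lam).
Proof.
move=> l0; have [hl|hl] := leP (enorm h) lam.
  by rewrite clip_id// subrr enorm0 le_max lexx.
have ph := le_lt_trans l0 hl.
rewrite clip_big// -{1}[h]scale1r -scalerBl enormZ.
rewrite ger0_norm; last by rewrite subr_ge0 ler_pdivrMr ?mul1r 1?ltW.
by rewrite mulrBl mul1r divfK ?gt_eqF// le_max lexx orbT.
Qed.

(** The ratio [2 * a / lam] is at least 1, hence at most its [p]-th power. The factor [2 ^ p] is at
    most 4, and halving leaves 2. *)
Lemma le_powR_half lam p a : 1 < p <= 2 -> 0 < lam -> lam / 2 <= a ->
  a <= 2 * lam `^ (1 - p) * a `^ p.
Proof.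
move=> /andP[p1 p2] l0 la.
have a0 : 0 < a by apply: lt_le_trans la; rewrite divr_gt0.
have r1 : 1 <= 2 * a / lam by rewrite ler_pdivlMr// mul1r; lra.
have := le1r_powR r1 (ltW p1).
rewrite !powRM ?invr_ge0 ?mulr_ge0 ?(ltW a0) ?(ltW l0)//.
rewrite -powR_inv1 ?(ltW l0)// -powRrM mulN1r => H.
have p4 : (2:R) `^ p <= 4.
  by apply: (le_trans (ler_powR _ p2)); rewrite ?ler1n// powR_mulrn// -natrX.
have -> : lam `^ (1 - p) = lam * lam `^ (- p).
  by rewrite powRD ?(gt_eqF l0) ?implybT// powRr1// ltW.
rewrite powR_inv1 ?(ltW l0)// in H.
have {}H := ler_wpM2l (ltW l0) H.
rewrite mulrC divfK ?gt_eqF// in H.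
have : lam * (2 `^ p * a `^ p * lam `^ (- p)) <= lam * (4 * a `^ p * lam `^ (- p)).
  by rewrite ler_wpM2l ?(ltW l0)// ler_wpM2r ?powR_ge0// ler_wpM2r ?powR_ge0.
lra.
Qed.

Lemma sqr_le_powR p a b c : p <= 2 -> 0 <= p -> 0 <= c -> c <= a -> c <= b ->
  c ^+ 2 <= b `^ (2 - p) * a `^ p.
Proof.
move=> p2 p0 c0 ca cb.
rewrite -powR_mulrn// -[2%:R in X in X <= _](subrK p) powRD ?subrK ?pnatr_eq0//.
by rewrite ler_pM ?powR_ge0 ?ge0_ler_powR ?nnegrE ?subr_ge0// (le_trans c0).
Qed.

(** Clipping bias. It vanishes unless [enorm h > lam]; then [enorm (h - g)] exceeds both [lam / 2]
    and the overshoot [enorm h - lam], and [le_powR_half] trades it for its [p]-th power. *)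
Lemma enorm_clipB_le lam p g h : 1 < p <= 2 -> 0 < lam -> enorm g <= lam / 2 ->
  enorm (clip lam h - h) <= 2 * lam `^ (1 - p) * enorm (h - g) `^ p.
Proof.
move=> p12 l0 gl; have [hl|hl] := leP (enorm h) lam.
  by rewrite clip_id// subrr enorm0 !mulr_ge0 ?powR_ge0.
have hg : enorm h <= enorm (h - g) + enorm g by rewrite -{1}[h](subrK g) enormD.
rewrite enormBC; apply: le_trans (enorm_clipB _ (ltW l0)) _.
apply: le_trans (@le_powR_half _ _ _ p12 l0 _); last lra.
rewrite ge_max enorm_ge0/=; lra.
Qed.

Lemma enorm_clipB_le_lam lam g h : 0 <= lam -> enorm g <= lam / 2 ->
  enorm (clip lam h - g) <= 3 / 2 * lam.
Proof.
by move=> l0 gl; have := enormB (clip lam h) g; have := enorm_clip h l0; lra.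
Qed.

(** The clipped deviation is at most [3 * enorm (h - g)]: if [h] is clipped,
    [enorm (h - g) > lam / 2] while the deviation is at most [3 / 2 * lam]. It is also at most
    [3 * lam]; [sqr_le_powR] interpolates between the two, and 9 is the square of 3. *)
Lemma sqr_enorm_clipB_le lam p g h : 1 < p <= 2 -> 0 < lam -> enorm g <= lam / 2 ->
  enorm (clip lam h - g) ^+ 2 <= 9 * lam `^ (2 - p) * enorm (h - g) `^ p.
Proof.
move=> /andP[p1 p2] l0 gl.
have h3 := enorm_clipB_le_lam h (ltW l0) gl.
suff h4 : enorm (clip lam h - g) <= 3 * enorm (h - g).
  have e3 (b c : R) : b <= 3 * c -> b / 3 <= c by move=> ?; lra.
  have := @sqr_le_powR p _ _ _ p2 (ltW (lt_trans ltr01 p1))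
    (divr_ge0 (enorm_ge0 _) (ler0n _ 3)) (e3 _ _ h4) (e3 _ lam _).
  by rewrite expr_div_n => /(_ _); lra.
have [hl|hl] := leP (enorm h) lam.
  by rewrite clip_id//; have := enorm_ge0 (h - g); lra.
have : enorm h <= enorm (h - g) + enorm g by rewrite -{1}[h](subrK g) enormD.
lra.
Qed.

End clipping.

(** From [expR (- x) >= 1 - x] one gets [expR x <= 1 / (1 - x)], and [(1 + x + 2 x^2) (1 - x) = 1 +
    x^2 (1 - 2 x)]. *)
Lemma expR_le_1Dx2 (R : realType) (x : R) : x <= 2^-1 -> expR x <= 1 + x + 2 * x ^+ 2.
Proof.
move=> x2; have x1 : 0 < 1 - x by lra.
have : (1 - x) * expR x <= 1.
  rewrite -ler_pdivlMr ?expR_gt0// div1r -expRN; have := expR_ge1Dx (- x); lra.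
rewrite -ler_pdivlMl// mulr1 => /le_trans; apply.
rewrite -[_^-1]mul1r ler_pdivrMr//.
have : 0 <= x ^+ 2 * (1 - 2 * x) by rewrite mulr_ge0 ?sqr_ge0//; lra.
lra.
Qed.

(** * Gradients, Bregman divergences and the mirror step *)

Section gradients.
Context {R : realType} {n : nat}.
Implicit Types (u v z : 'rV[R]_n) (X : set 'rV[R]_n).

Lemma has_gradient_quotient (g : 'rV[R]_n -> R) dg z v (e : R) :
  has_gradient_at g dg z -> 0 < e ->
  exists2 s0, 0 < s0 & forall s, 0 < s < s0 ->
    `|g (z + s *: v) - g z - s * dotv (dg z) v| <= s * e.
Proof.
move=> [dfg dE] e0.
have dgv : derivable g z v by exact: diff_derivable.
have Dv : 'D_v g z = dotv (dg z) v by rewrite deriveE// dE.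
have : (fun h : R => h^-1 *: ((g \o shift z) (h *: v) - g z)) @ 0^' --> 'D_v g z.
  by move: dgv => /cvg_ex[l hl]; rewrite /derive (cvg_lim _ hl).
move=> /cvgrPdist_le/(_ e e0) [s0 /= s00 H]; exists s0 => // s /andP[sp ss].
have := H s; rewrite /ball_/= sub0r normrN gtr0_norm// => /(_ ss).
rewrite gt_eqF// => /(_ isT); rewrite Dv distrC.
have -> : s^-1 *: (g (s *: v + z) - g z) - dotv (dg z) v
  = s^-1 * (g (z + s *: v) - g z - s * dotv (dg z) v).
  by rewrite /GRing.scale/= [s *: v + z]addrC [RHS]mulrBr mulKf ?gt_eqF.
by rewrite normrM gtr0_norm ?invr_gt0// ler_pdivrMl.
Qed.

Lemma has_gradient_continuous (g : 'rV[R]_n -> R) dg z (e : R) :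
  has_gradient_at g dg z -> 0 < e ->
  exists2 r, 0 < r & forall z', enorm (z' - z) < r -> `|g z' - g z| < e.
Proof.
move=> [/differentiable_continuous cg _] e0.
move: cg => /cvgrPdist_lt/(_ e e0)/nbhs_ballP[r /= r0 H]; exists r => // z' zz.
rewrite distrC; apply: H; split=> // i j; rewrite ord1 -ball_normE /ball_/= distrC.
apply: le_lt_trans zz.
by have := coord_le_enorm (z' - z) j; rewrite !mxE.
Qed.

Lemma convex_set_segment X u v (s : R) : convex_set X -> X u -> X v ->
  0 <= s <= 1 -> X (u + s *: (v - u)).
Proof.
move=> cX Xu Xv /andP[s0 s1].
have := cX v u (Itv01 s0 s1) (mem_set Xv) (mem_set Xu) => /set_mem.
suff -> : u + s *: (v - u) = s *: v + (1 - s) *: u by [].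
by rewrite scalerBl scale1r scalerBr addrCA.
Qed.

Lemma convex_function_segment X (f : 'rV[R]_n -> R) u v (s : R) :
  convex_function X f -> X u -> X v -> 0 <= s <= 1 ->
  f (u + s *: (v - u)) <= f u + s * (f v - f u).
Proof.
move=> cf Xu Xv /andP[s0 s1].
have := cf (Itv01 s0 s1) v u (mem_set Xv) (mem_set Xu).
have -> : u + s *: (v - u) = s *: v + (1 - s) *: u.
  by rewrite scalerBl scale1r scalerBr addrCA.
rewrite convRE/= /unstable.onem => /le_trans; apply.
by rewrite le_eqVlt; apply/orP; left; apply/eqP; ring.
Qed.

Lemma convex_gradient_le X (f : 'rV[R]_n -> R) gradf u v :
  convex_function X f -> has_gradient_at f gradf u -> X u -> X v ->
  dotv (gradf u) (v - u) <= f v - f u.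
Proof.
move=> cf gf Xu Xv; apply/ler_addgt0Pr => e e0.
have [s0 s00 H] := has_gradient_quotient (v - u) gf e0.
pose s := Num.min 1 (s0 / 2).
have sp : 0 < s by rewrite lt_min ltr01 divr_gt0.
have ss : s < s0 by rewrite gt_min; apply/orP; right; lra.
have s1 : s <= 1 by rewrite ge_min lexx.
have := H s; rewrite sp ss => /(_ isT); rewrite ler_norml => /andP[h1 h2].
have h3 : f (u + s *: (v - u)) <= f u + s * (f v - f u).
  by apply: (convex_function_segment cf) => //; rewrite s1 ltW.
rewrite -(ler_pM2l sp) mulrDr; lra.
Qed.

Lemma convex_set_mean X (I : Type) (i0 : I) (s : seq I) (F : I -> 'rV[R]_n) :
  convex_set X -> (forall i, X (F i)) ->
  X ((size (i0 :: s))%:R^-1 *: \sum_(i <- i0 :: s) F i).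
Proof.
move=> cX XF; elim: s i0 => [|i1 s IH] i0.
  by rewrite big_seq1 invr1 scale1r.
set k := size (i1 :: s); have IH1 := IH i1; rewrite -/k in IH1.
rewrite big_cons [size _]/= -/k.
have k0 : (k.+1%:R : R) != 0 by rewrite pnatr_eq0.
have k00 : (k%:R : R) != 0 by rewrite pnatr_eq0.
have := @convex_set_segment X (F i0) (k%:R^-1 *: \sum_(j <- i1 :: s) F j)
  (k%:R / k.+1%:R) cX (XF i0) IH1.
rewrite divr_ge0// ler_pdivrMr ?ltr0n// mul1r ler_nat leqnSn => /(_ isT).
congr X; rewrite scalerBr scalerA mulrAC divff// mul1r scalerDr addrCA addrC.
congr (_ + _); rewrite -{1}[F i0]scale1r -scalerBl; congr (_ *: _).
by apply: (mulIf k0); rewrite mulrBl mul1r divfK// mulVf// -natrB// subSnn.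
Qed.

Lemma bregman_ge (Phi : 'rV[R]_n -> R) gradPhi u v :
  Phi u - Phi v >= dotv (gradPhi v) (u - v) + 2^-1 * enorm (u - v) ^+ 2 ->
  2^-1 * enorm (u - v) ^+ 2 <= bregman Phi gradPhi u v.
Proof. rewrite /bregman; lra. Qed.

Lemma dist_le_sqrt_bregman (Phi : 'rV[R]_n -> R) gradPhi u v :
  Phi u - Phi v >= dotv (gradPhi v) (u - v) + 2^-1 * enorm (u - v) ^+ 2 ->
  enorm (v - u) <= Num.sqrt (2 * bregman Phi gradPhi u v).
Proof.
move=> /bregman_ge h.
have b0 : 0 <= bregman Phi gradPhi u v.
  by apply: le_trans h; rewrite mulr_ge0 ?sqr_ge0.
rewrite enormBC -(ler_pXn2r (ltn0Sn 1)) ?nnegrE ?enorm_ge0 ?sqrtr_ge0//.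
by rewrite [leRHS]sqr_sqrtr ?mulr_ge0//; lra.
Qed.

Lemma bregman_three_points (Phi : 'rV[R]_n -> R) gradPhi u v z :
  bregman Phi gradPhi z u - bregman Phi gradPhi z v - bregman Phi gradPhi v u =
  dotv (gradPhi v - gradPhi u) (z - v).
Proof. by rewrite /bregman dotvBl !dotvBr; ring. Qed.

(** First-order optimality along the segment from [v] to [z], which stays in [X]: if the slope [c]
    of the scaled objective in that direction were negative, a short step would lower the objective
    by at least half the linear prediction. The three-point identity turns the sign of the slope
    into the claim. *)
Lemma mirror_step_le X (Phi : 'rV[R]_n -> R) gradPhi (al : R) g u v z :
  convex_set X -> 0 < al -> X v -> X z -> has_gradient_at Phi gradPhi v ->
  (forall z', X z' -> dotv g v + al^-1 * bregman Phi gradPhi v u <=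
                      dotv g z' + al^-1 * bregman Phi gradPhi z' u) ->
  al * dotv g (v - z) <=
  bregman Phi gradPhi z u - bregman Phi gradPhi z v - bregman Phi gradPhi v u.
Proof.
move=> cX al0 Xv Xz gP vmin; rewrite bregman_three_points.
rewrite -[v - z]opprB dotvNr mulrN; set w := z - v.
rewrite -subr_ge0 opprK leNgt; apply/negP => c0.
set c := _ + _ in c0.
have e0 : 0 < - c / 2 by lra.
have [s0 s00 H] := has_gradient_quotient w gP e0.
pose s := Num.min 1 (s0 / 2).
have sp : 0 < s by rewrite lt_min ltr01 divr_gt0.
have ss : s < s0 by rewrite gt_min; apply/orP; right; lra.
have s1 : s <= 1 by rewrite ge_min lexx.
have := H s; rewrite sp ss => /(_ isT); rewrite ler_norml => /andP[h1 h2].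
have Xs : X (v + s *: w) by apply: convex_set_segment; rewrite ?s1 ?(ltW sp).
have := vmin _ Xs; rewrite -(ler_pM2l al0) !mulrDr !mulVKf ?gt_eqF//.
have ew : v + s *: w - u = v - u + s *: w by rewrite addrAC.
clearbody w; rewrite /bregman ew !dotvDr !dotvZr => h3.
have h4 : s * c = s * (dotv (gradPhi v) w) - s * dotv (gradPhi u) w + s * (al * dotv g w).
  by rewrite /c dotvBl; ring.
have h5 : s * (- c / 2) = - (s * c) / 2 by ring.
have h6 : s * c < 0 by rewrite pmulr_rlt0.
lra.
Qed.

(* The Bregman divergences in both directions dominate the squared distance. *)
Lemma mirror_step_dist X (Phi : 'rV[R]_n -> R) gradPhi (al : R) g u v :
  convex_set X -> 0 < al -> X u -> X v ->
  (forall z, X z -> has_gradient_at Phi gradPhi z) ->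
  (forall z z', X z -> X z' ->
     Phi z - Phi z' >= dotv (gradPhi z') (z - z') + 2^-1 * enorm (z - z') ^+ 2) ->
  (forall z', X z' -> dotv g v + al^-1 * bregman Phi gradPhi v u <=
                      dotv g z' + al^-1 * bregman Phi gradPhi z' u) ->
  enorm (v - u) <= al * enorm g.
Proof.
move=> cX al0 Xu Xv gP sP vmin.
have := mirror_step_le cX al0 Xv Xu (gP v Xv) vmin.
have -> : bregman Phi gradPhi u u = 0 by rewrite /bregman !subrr dotv0r subr0.
have := bregman_ge (sP _ _ Xu Xv); rewrite enormBC.
have := bregman_ge (sP _ _ Xv Xu).
have := dotv_le (- g) (v - u); rewrite enormN dotvNl => h1 h2 h3 h4.
have [->|h0] := eqVneq (enorm (v - u)) 0; first by rewrite mulr_ge0 ?enorm_ge0 ?ltW.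
have hp : 0 < enorm (v - u) by rewrite lt_def h0 enorm_ge0.
have h5 : al * - dotv g (v - u) <= al * (enorm g * enorm (v - u)).
  by rewrite ler_pM2l.
rewrite -(ler_pM2r hp) -expr2; lra.
Qed.

End gradients.

(** * Measurability of minimizers *)

Lemma invrS_lt (R : realType) (e : R) : 0 < e -> exists N, N.+1%:R^-1 < e.
Proof.
move=> e0; have [N _ /(_ N (leqnn _)) NN] := near_infty_natSinv_lt (PosNum e0).
by exists N.
Qed.

Section measurability.
Context {R : realType} {n : nat} {d : measure_display} {T : measurableType d}.
Implicit Types (u v : T -> 'rV[R]_n) (X : set 'rV[R]_n).

Lemma measurable_fun_lt_set (h : T -> R) :
  (forall a, measurable [set w | h w < a]) -> measurable_fun setT h.
Proof.
move=> mh; apply: (measurability _ (RGenInftyO.measurableE R)) => //.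
move=> _ [_ [a ->] <-]; rewrite setTI.
by rewrite (_ : _ @^-1` _ = [set w | h w < a])//; apply/seteqP; split => w /=; rewrite in_itv.
Qed.

Lemma measurable_lt_cst (h : T -> R) a : measurable_fun setT h ->
  measurable [set w | h w < a].
Proof.
move=> mh; have := mh measurableT `]-oo, a[%classic (measurable_itv _).
rewrite setTI (_ : _ @^-1` _ = [set w | h w < a])//.
Qed.

Lemma measurable_dotv u v : (forall k, measurable_fun setT (fun w => u w 0 k)) ->
  (forall k, measurable_fun setT (fun w => v w 0 k)) ->
  measurable_fun setT (fun w => dotv (u w) (v w)).
Proof. by move=> mu mv; apply: measurable_sum => k; exact: measurable_funM. Qed.

Lemma measurable_enorm u : (forall k, measurable_fun setT (fun w => u w 0 k)) ->
  measurable_fun setT (fun w => enorm (u w)).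
Proof.
move=> mu; rewrite /enorm.
under eq_fun do rewrite -powR12_sqrt ?dotvv_ge0//.
by apply: measurableT_comp (measurable_powR _) _; exact: measurable_dotv.
Qed.

Lemma measurable_mxB u v k : measurable_fun setT (fun w => u w 0 k) ->
  measurable_fun setT (fun w => v w 0 k) ->
  measurable_fun setT (fun w => (u w - v w) 0 k).
Proof. by move=> mu mv; under eq_fun do rewrite !mxE; exact: measurable_funB. Qed.

Lemma measurable_clip (lam : R) u k :
  (forall j, measurable_fun setT (fun w => u w 0 j)) ->
  measurable_fun setT (fun w => clip lam (u w) 0 k).
Proof.
move=> mu; under eq_fun do rewrite mxE.
apply: measurable_funM => //; apply: measurable_minr => //.
apply: measurable_funM => //.
under eq_fun do rewrite -powR_inv1 ?enorm_ge0//.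
by apply: measurableT_comp (measurable_powR _) _; exact: measurable_enorm.
Qed.

Variables (X : set 'rV[R]_n) (D : nat -> 'rV[R]_n).
Hypothesis XD : forall k, X (D k).
Hypothesis densD : forall z, X z -> forall e, 0 < e -> exists k, enorm (D k - z) < e.

(** Continuity is relative to [X]: the set where [g] of [u] is below [a] is a countable union of
    preimages of balls, centred at dense points, in which [g < a] on [X]. *)
Lemma measurable_continuous_comp u (g : 'rV[R]_n -> R) :
  (forall k, measurable_fun setT (fun w => u w 0 k)) -> (forall w, X (u w)) ->
  (forall z, X z -> forall e, 0 < e ->
    exists2 r, 0 < r & forall z', X z' -> enorm (z' - z) < r -> `|g z' - g z| < e) ->
  measurable_fun setT (g \o u).
Proof.
move=> mu Xu cg; apply: measurable_fun_lt_set => a.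
pose S k N : set T := [set w | (forall z, X z -> enorm (z - D k) < N.+1%:R^-1 -> g z < a)
  /\ enorm (u w - D k) < N.+1%:R^-1].
rewrite (_ : [set w | _] = \bigcup_k \bigcup_N S k N); last first.
  apply/seteqP; split => w /=; last first.
    by move=> [k _ [N _ [H1 H2]]]; exact: H1.
  move=> gw; have [r r0 Hr] := cg _ (Xu w) _ (eqbRL (subr_gt0 _ _) gw).
  have [N NN] := invrS_lt (divr_gt0 r0 (ltr0n R 2)).
  have N0 : 0 < N.+1%:R^-1 :> R by rewrite invr_gt0 ltr0n.
  have [k Dk] := densD (Xu w) N0.
  exists k => //; exists N => //; split; last by rewrite enormBC.
  move=> z Xz zD; have : enorm (z - u w) < r.
    move: zD NN Dk (enorm_dist (D k) z (u w)); rewrite (enormBC (D k)).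
    move: (N.+1%:R^-1 : R) => c; lra.
  by move/(Hr z Xz); rewrite ltr_norml; lra.
apply: bigcupT_measurable => k; apply: bigcupT_measurable => N.
have [H|H] := pselect (forall z, X z -> enorm (z - D k) < N.+1%:R^-1 -> g z < a).
  rewrite (_ : S k N = [set w | enorm (u w - D k) < N.+1%:R^-1]).
    apply: measurable_lt_cst; apply: measurable_enorm => j.
    exact: measurable_mxB.
  by apply/seteqP; split => w /= => [[]|].
by rewrite (_ : S k N = set0)//; apply/seteqP; split => w //= [].
Qed.

(* The minimizer is the limit of any sequence of near-minimizers taken from a
   countable dense set, hence inherits measurability from the values there. *)
Lemma measurable_argmin v (h : T -> 'rV[R]_n -> R) k :
  (forall j, measurable_fun setT (fun w => h w (D j))) ->
  (forall w, X (v w)) ->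
  (forall w z, X z -> 2^-1 * enorm (z - v w) ^+ 2 <= h w z - h w (v w)) ->
  (forall w e, 0 < e -> exists2 r, 0 < r & forall z, X z -> enorm (z - v w) < r ->
     h w z < h w (v w) + e) ->
  measurable_fun setT (fun w => v w 0 k).
Proof.
move=> mh Xv hv ch; apply: measurable_fun_lt_set => a.
(* In [S N M] every dense point is either beaten by another one by more than [1 / (M + 1)] or has
   its [k]-th coordinate below [a - 1 / (N + 1)]. Only values of [h] at dense points occur. *)
pose S (N M : nat) : set T := \bigcap_j ((\bigcup_i [set w | h w (D i) - h w (D j) < - M.+1%:R^-1]) `|`
   [set w | D j 0 k < a - N.+1%:R^-1]).
have near w e : 0 < e -> exists j, enorm (D j - v w) < e /\ h w (D j) < h w (v w) + e.
  move=> e0; have [r r0 Hr] := ch w e e0.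
  have [|j Dj] := @densD (v w) (Xv w) (Num.min r e); first by rewrite lt_min r0.
  rewrite lt_min in Dj; case/andP: Dj => jr je.
  by exists j; split => //; apply: Hr.
rewrite (_ : [set w | _] = \bigcup_N \bigcup_M S N M); last first.
  apply/seteqP; split => w /=.
    move=> va; pose e := (a - v w 0 k) / 3.
    have e0 : 0 < e by rewrite /e; lra.
    have [N NN] := invrS_lt e0.
    (* By the quadratic growth [hv], a point farther than [e] from [v w] is worse by more than
       [e ^ 2 / 2]. Half of this is left to a dense near-minimizer, the other half is the margin by
       which it wins. *)
    have e20 : 0 < 2^-1 * e ^+ 2 / 2 by rewrite divr_gt0// mulr_gt0// exprn_gt0.
    have [M MM] := invrS_lt e20.
    exists N => //; exists M => // j _ /=.
    have [Dj|Dj] := ltP (D j 0 k) (a - N.+1%:R^-1); [by right|left].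
    have ej : e < enorm (D j - v w).
      apply: lt_le_trans (coord_le_enorm (D j - v w) k); rewrite !mxE.
      apply: lt_le_trans (ler_norm _); move: Dj NN; rewrite /e.
      by move: (N.+1%:R^-1 : R) => c; lra.
    have hj : 2^-1 * e ^+ 2 < h w (D j) - h w (v w).
      apply: lt_le_trans (hv w _ (XD j)).
      by rewrite ltr_pM2l// ltr_pXn2r// nnegrE ?enorm_ge0// ltW.
    have [i [_ hi]] := near w _ e20.
    exists i => //=; move: MM hj hi; move: (M.+1%:R^-1 : R) (e ^+ 2) => b c; lra.
  move=> [N _ [M _ SNM]].
  have N0 : 0 < N.+1%:R^-1 :> R by rewrite invr_gt0 ltr0n.
  have M0 : 0 < M.+1%:R^-1 :> R by rewrite invr_gt0 ltr0n.
  have [|j [jN jM]] := near w (Num.min N.+1%:R^-1 M.+1%:R^-1); first by rewrite lt_min N0.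
  have [[i _ /= hi]|/= Dj] := SNM j I.
    have := hv w _ (XD i).
    have : 0 <= 2^-1 * enorm (D i - v w) ^+ 2 by rewrite mulr_ge0 ?sqr_ge0.
    have : Num.min N.+1%:R^-1 M.+1%:R^-1 <= M.+1%:R^-1 :> R by rewrite ge_min lexx orbT.
    move: jM hi; move: (Num.min N.+1%:R^-1 M.+1%:R^-1 : R) (M.+1%:R^-1 : R) => b c; lra.
  have := coord_le_enorm (D j - v w) k; rewrite !mxE ler_norml => /andP[h1 h2].
  have : Num.min N.+1%:R^-1 M.+1%:R^-1 <= N.+1%:R^-1 :> R by rewrite ge_min lexx.
  move: Dj jN; move: (Num.min N.+1%:R^-1 M.+1%:R^-1 : R) (N.+1%:R^-1 : R) => b c; lra.
apply: bigcupT_measurable => N; apply: bigcupT_measurable => M.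
apply: bigcapT_measurable => j; apply: measurableU.
  apply: bigcupT_measurable => i; apply: measurable_lt_cst.
  exact: measurable_funB.
by apply: measurable_lt_cst.
Qed.

End measurability.

(** For each radius [1 / (N + 1)] and rational centre, a point of [X] within that radius is chosen
    when one exists; [z0] is the default for other pairs and for codes of no pair. *)
Lemma dense_sequence (R : realType) (n : nat) (X : set 'rV[R]_n) :
  X !=set0 -> exists2 D : nat -> 'rV[R]_n, (forall k, X (D k)) &
    forall z, X z -> forall e, 0 < e -> exists k, enorm (D k - z) < e.
Proof.
move=> [z0 Xz0].
pose Q (q : nat * 'rV[rat]_n) (z : 'rV[R]_n) :=
  X z /\ enorm (z - map_mx ratr q.2) < q.1.+1%:R^-1.
have /choice[F HF] : forall q, exists z, X z /\ ((exists z', Q q z') -> Q q z).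
  move=> q; have [[z' Qz']|nQ] := pselect (exists z', Q q z').
    by exists z'; split => //; case: Qz'.
  by exists z0; split => // /nQ.
exists (fun k => if @unpickle (nat * 'rV[rat]_n)%type k is Some q then F q else z0).
  by move=> k; case: unpickle => [q|//]; case: (HF q).
move=> z Xz e e0.
have [N NN] := invrS_lt (divr_gt0 e0 (ltr0n R 2)).
(* Dividing by [n + 1] instead of [n] covers [n = 0] and keeps the sum of the [n] coordinate errors
   strictly below the radius. *)
pose c : R := N.+1%:R^-1 / n.+1%:R.
have c0 : 0 < c by rewrite divr_gt0// ?invr_gt0 ltr0n.
have /choice[q Hq] : forall k : 'I_n, exists q : rat, `|z 0 k - ratr q| < c.
  move=> k; have [|q] := @rat_in_itvoo _ (z 0 k - c) (z 0 k + c); first by lra.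
  rewrite in_itv/= => /andP[h1 h2]; exists q; rewrite ltr_norml; lra.
pose qv := \row_k q k.
have Hz : Q (N, qv) z.
  split => //=; apply: le_lt_trans (enorm_le_sum _) _.
  apply: (@le_lt_trans _ _ (\sum_(k < n) c)).
    by apply: ler_sum => k _; rewrite !mxE ltW.
  rewrite sumr_const card_ord -[_ *+ n]mulr_natr /c -mulrA gtr_pMr ?invr_gt0 ?ltr0n//.
  by rewrite ltr_pdivrMl ?ltr0n// mulr1 ltr_nat.
exists (pickle (N, qv)); rewrite pickleK.
have [_ /(_ (ex_intro _ _ Hz))[_ /= h1]] := HF (N, qv).
have [_ /= h2] := Hz.
have := enorm_dist (map_mx ratr qv) (F (N, qv)) z.
rewrite (enormBC (map_mx _ _) z); move: h1 h2 NN; move: (N.+1%:R^-1 : R) => b; lra.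
Qed.

(** * Exponential supermartingales *)

Section sub_sigma_algebra.
Context {R : realType} {d : measure_display} {T : measurableType d}.
Variables (P : probability T R) (G : set (set T)).
Hypothesis GT : forall S, <<s G >> S -> measurable S.
Let F := g_sigma_algebraType G.
Local Open Scope ereal_scope.

Lemma sub_measurable_fun (h : T -> R) :
  measurable_fun setT (h : F -> R) -> measurable_fun setT h.
Proof. by move=> mh _ B mB; apply: GT; exact: (mh measurableT). Qed.

Import HBNNSimple.

Section mulr.
Variables (H : T -> R) (g1 g2 : T -> R).
Hypotheses (H0 : forall w, (0 <= H w)%R) (mH : measurable_fun setT (H : F -> R)).

Let mHE : measurable_fun setT (EFin \o (H : F -> R)).
Proof. exact/measurable_EFinP. Qed.
Let h : {nnsfun F >-> R}^nat := nnsfun_approx measurableT mHE.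

Let mh N : measurable_fun setT (h N : T -> R).
Proof. by apply: sub_measurable_fun; exact: measurable_funP. Qed.

Let cvg_integral_mul (g : T -> R) : (forall w, (0 <= g w)%R) -> measurable_fun setT g ->
  \int[P]_w (h N w * g w)%:E @[N --> \oo] --> \int[P]_w (H w * g w)%:E.
Proof.
move=> g0 mg.
have -> : \int[P]_w (H w * g w)%:E = \int[P]_w limn (fun N => (h N w * g w)%:E).
  apply: eq_integral => w _; apply/esym/cvg_lim => //.
  under eq_fun do rewrite EFinM; rewrite EFinM; apply: cvgeZr => //.
  exact: (@cvg_nnsfun_approx _ _ _ _ measurableT _ mHE (fun x _ => H0 x) w I).
apply: cvg_monotone_convergence => //.
- by move=> N; apply/measurable_EFinP; apply: measurable_funM.
- by move=> N w _; rewrite lee_fin mulr_ge0.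
- by move=> w _ a b ab; rewrite lee_fin ler_wpM2r//; move: w; apply/lefP; exact: (nd_nnsfun_approx measurableT mHE ab).
Qed.

Let integral_mul_approx (g : T -> R) N : (forall w, (0 <= g w)%R) -> measurable_fun setT g ->
  \int[P]_w (h N w * g w)%:E =
  \sum_(y \in range (h N)) (y%:E * \int[P]_(w in h N @^-1` [set y]) (g w)%:E).
Proof.
move=> g0 mg.
have mS y : measurable (h N @^-1` [set y] : set T).
  by have := mh N measurableT (measurable_set1 y); rewrite setTI.
have yh y w : (0 <= y * \1_(h N @^-1` [set y]) w)%R.
  rewrite indicE; have [/set_mem/= <-|] := boolP (_ \in _); last by rewrite mulr0.
  by rewrite mulr1.
transitivity (\int[P]_w \sum_(y \in range (h N)) (y * \1_(h N @^-1` [set y]) w * g w)%:E).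
  apply: eq_integral => w _; rewrite EFinM fimfunE -fsumEFin//.
  by rewrite ge0_mule_fsuml// => y; rewrite lee_fin.
rewrite ge0_integral_fsum//; last 2 first.
- by move=> y; apply/measurable_EFinP; do 2!apply: measurable_funM => //.
- by move=> y w _; rewrite lee_fin mulr_ge0.
apply: eq_fsbigr => y /set_mem [w0 _ yw].
have y0 : (0 <= y)%R by rewrite -yw.
rewrite -ge0_integralZl_EFin//; last exact/measurable_funTS/measurable_EFinP.
rewrite [RHS]integral_mkcond; apply: eq_integral => w _.
rewrite patchE indicE; case: ifPn => // _; last by rewrite mulr0 mul0r.
  by rewrite mulr1 EFinM.
by move=> w _; rewrite lee_fin.
Qed.

(** This replaces taking an [F]-measurable factor out of a conditional expectation: for simple
    functions of [F] it is the hypothesis on sets, and monotone convergence gives the general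
    weight. *)
Lemma le_integral_sub_mul :
  (forall w, (0 <= g1 w)%R) -> measurable_fun setT g1 ->
  (forall w, (0 <= g2 w)%R) -> measurable_fun setT g2 ->
  (forall S, <<s G >> S -> \int[P]_(w in S) (g1 w)%:E <= \int[P]_(w in S) (g2 w)%:E) ->
  \int[P]_w (H w * g1 w)%:E <= \int[P]_w (H w * g2 w)%:E.
Proof.
move=> g10 mg1 g20 mg2 g12.
apply: (lee_cvg_to (cvg_integral_mul g10 mg1) (cvg_integral_mul g20 mg2)).
apply: nearW => N; rewrite !integral_mul_approx//.
apply: lee_fsum => // y [w0 _ <-]; apply: lee_wpmul2l; first by rewrite lee_fin.
have hm : measurable_fun setT (h N : F -> R) by exact: measurable_funP.
by apply: g12; have := hm measurableT _ (measurable_set1 (h N w0)); rewrite setTI.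
Qed.

End mulr.

Lemma integrable_bounded_mul (H z : T -> R) (M : R) :
  measurable_fun setT (H : F -> R) -> (forall w, (`|H w| <= M)%R) ->
  P.-integrable setT (EFin \o z) ->
  P.-integrable setT (EFin \o (fun w => H w * z w)%R).
Proof.
move=> mH HM iz.
have mz : measurable_fun setT z by apply/measurable_EFinP; exact: measurable_int iz.
apply: (le_integrable measurableT _ _ (integrableZl measurableT M iz)).
  by apply/measurable_EFinP; apply: measurable_funM => //; exact: sub_measurable_fun.
move=> w _ /=; rewrite lee_fin !normrM ler_wpM2r// (le_trans (HM w))//.
exact: ler_norm.
Qed.

(** [le_integral_sub_mul] compares nonnegative functions; [|z| + z] and [|z|] are nonnegative and
    have the same integral over every set of the sub-sigma-algebra. *)
Lemma integral_mul_centered_ge0 (H z : T -> R) (M : R) :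
  measurable_fun setT (H : F -> R) -> (forall w, (0 <= H w <= M)%R) ->
  P.-integrable setT (EFin \o z) ->
  (forall S, <<s G >> S -> \int[P]_(w in S) (z w)%:E = 0) ->
  \int[P]_w (H w * z w)%:E = 0.
Proof.
move=> mH HM iz z0.
have H0 w : (0 <= H w)%R by case/andP: (HM w).
have HM' w : (`|H w| <= M)%R by rewrite ger0_norm//; case/andP: (HM w).
have mz : measurable_fun setT z by apply/measurable_EFinP; exact: measurable_int iz.
have iaz : P.-integrable setT (EFin \o (fun w => `|z w|%R)) by exact: integrable_norm.
have maz : measurable_fun setT (fun w => `|z w|%R) by exact: measurableT_comp.
have z10 w : (0 <= `|z w| + z w)%R by have := ler_norm (- z w); rewrite normrN; lra.
have mz1 : measurable_fun setT (fun w => (`|z w| + z w)%R) by exact: measurable_funD.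
have eqS S : <<s G >> S -> \int[P]_(w in S) (`|z w| + z w)%:E = \int[P]_(w in S) (`|z w|)%:E.
  move=> GS; have mS := GT GS; under eq_integral do rewrite EFinD.
  rewrite integralD//; first by rewrite z0// adde0.
    exact: (integrableS measurableT _ _ iaz).
  exact: (integrableS measurableT _ _ iz).
have : \int[P]_w (H w * (`|z w| + z w))%:E = \int[P]_w (H w * `|z w|)%:E.
  by apply/eqP; rewrite eq_le !le_integral_sub_mul// => S GS; rewrite eqS.
under eq_integral do rewrite mulrDr EFinD.
have i1 := integrable_bounded_mul mH HM' iaz.
rewrite integralD//; last exact: (integrable_bounded_mul mH HM' iz).
have Xf := integrable_fin_num measurableT i1.
move=> E; set Y := (X in X = 0); rewrite -(addeK Y Xf) [Y + _]addeC.
by rewrite [X in X - _]E subee.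
Qed.

(** Adding [M] makes the weight nonnegative, and the added part integrates to zero. *)
Lemma integral_mul_centered (H z : T -> R) (M : R) :
  measurable_fun setT (H : F -> R) -> (forall w, (`|H w| <= M)%R) ->
  P.-integrable setT (EFin \o z) ->
  (forall S, <<s G >> S -> \int[P]_(w in S) (z w)%:E = 0) ->
  \int[P]_w (H w * z w)%:E = 0.
Proof.
move=> mH HM iz z0.
have : \int[P]_w ((H w + M) * z w)%:E = 0.
  apply: (@integral_mul_centered_ge0 (fun w => H w + M)%R _ (M + M)%R) => //.
    exact: measurable_funD.
  by move=> w; have := HM w; rewrite ler_norml; lra.
under eq_integral do rewrite mulrDl EFinD.
rewrite integralD//; last 2 first.
- exact: (integrable_bounded_mul mH HM iz).
- by under eq_fun do rewrite EFinM; exact: integrableZl.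
under [X in _ + X]eq_integral do rewrite EFinM.
rewrite integralZl// z0 ?mule0 ?adde0//.
exact: (@measurableT _ F).
Qed.

(* One step of an exponential supermartingale: the pointwise bound on [Z] is
   linear in the conditionally centered variables [z j]. *)
Lemma integral_mul_le_of_linear_bound (J : finType) (b z : J -> T -> R) (q Z H : T -> R)
    (C M : R) :
  (forall j, measurable_fun setT (b j : F -> R)) ->
  (forall j w, (`|b j w| <= M)%R) ->
  (forall j, P.-integrable setT (EFin \o z j)) ->
  (forall j S, <<s G >> S -> \int[P]_(w in S) (z j w)%:E = 0) ->
  (forall w, (0 <= q w)%R) -> P.-integrable setT (EFin \o q) ->
  (0 <= C)%R ->
  (forall S, <<s G >> S -> \int[P]_(w in S) (q w)%:E <= C%:E * P S) ->
  measurable_fun setT Z ->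
  (forall w, (0 <= Z w <= 1 + \sum_j b j w * z j w + q w)%R) ->
  measurable_fun setT (H : F -> R) -> (forall w, (0 <= H w <= M)%R) ->
  \int[P]_w (H w * Z w)%:E <= (1 + C)%:E * \int[P]_w (H w)%:E.
Proof.
move=> mb bM iz z0 q0 iq C0 qC mZ ZB mH HM.
have H0 w : (0 <= H w)%R by case/andP: (HM w).
have HM' w : (`|H w| <= M)%R by rewrite ger0_norm//; case/andP: (HM w).
have mHT := sub_measurable_fun mH.
have iH : P.-integrable setT (EFin \o H).
  rewrite (_ : EFin \o H = EFin \o (fun w => H w * cst 1 w)%R); last first.
    by apply/funext => w /=; rewrite mulr1.
  apply: (integrable_bounded_mul mH HM').
  exact: finite_measure_integrable_cst.
have iHbz j : P.-integrable setT (EFin \o (fun w => (H w * b j w) * z j w)%R).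
  apply: (@integrable_bounded_mul (fun w => H w * b j w)%R _ (M * M)%R) => //.
    exact: measurable_funM.
  by move=> w; rewrite normrM ler_pM.
have Hbz0 j : \int[P]_w (H w * b j w * z j w)%:E = 0.
  apply: (@integral_mul_centered (fun w => H w * b j w)%R _ (M * M)%R) => //.
  - exact: measurable_funM.
  - by move=> w; rewrite normrM ler_pM.
  - exact: z0.
have iHq := integrable_bounded_mul mH HM' iq.
have iS : P.-integrable setT (fun w => \sum_j (H w * b j w * z j w)%:E).
  by apply: integrable_sum => // j _; exact: iHbz.
have mq : measurable_fun setT q by apply/measurable_EFinP; exact: measurable_int iq.
apply: (@le_trans _ _ (\int[P]_w ((H w)%:E + \sum_j (H w * b j w * z j w)%:E
    + (H w * q w)%:E))).
  have iR : P.-integrable setT (fun w => (H w)%:E + \sum_j (H w * b j w * z j w)%:E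
    + (H w * q w)%:E).
    by apply: integrableD => //; exact: integrableD.
  apply: ge0_le_integral => //.
  - by move=> w _; rewrite lee_fin mulr_ge0//; case/andP: (ZB w).
  - by apply/measurable_EFinP; exact: measurable_funM.
  - exact: measurable_int iR.
  - move=> w _; rewrite sumEFin -!EFinD lee_fin.
    case/andP: (ZB w) => _ /(ler_wpM2l (H0 w)) /le_trans; apply.
    rewrite !mulrDr mulr1 mulr_sumr lerD2r lerD2l le_eqVlt; apply/orP; left.
    by apply/eqP; apply: eq_bigr => j _; rewrite mulrA.
rewrite integralD//; last exact: integrableD.
rewrite integralD// integral_sum// big1// adde0 EFinD.
rewrite ge0_muleDl ?lee_fin// mul1e; apply: leeD => //.
apply: (@le_trans _ _ (\int[P]_w (H w * cst C w)%:E)).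
  apply: le_integral_sub_mul => // S GS; apply: le_trans (qC S GS) _.
  by rewrite (_ : \int[P]_(w in S) _ = C%:E * P S)//; exact: (integral_cst P (GT GS) C%:E).
under eq_integral do rewrite mulrC EFinM.
by rewrite integralZl.
Qed.

End sub_sigma_algebra.

Lemma measurable_fun_sub_sigma_algebra (R : realType) (T : pointedType)
    (G1 G2 : set (set T)) (h : T -> R) :
  G1 `<=` G2 ->
  measurable_fun setT (h : g_sigma_algebraType G1 -> R) ->
  measurable_fun setT (h : g_sigma_algebraType G2 -> R).
Proof.
move=> G12 mh _ B mB; apply: (sub_sigma_algebra2 G12).
exact: (mh measurableT B mB).
Qed.

(** * Ville's maximal inequality *)

Section ville.
Context {R : realType} {d : measure_display} {T : measurableType d}.
Variables (P : probability T R) (G : nat -> set (set T)).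
Hypothesis GT : forall t S, <<s G t >> S -> measurable S.
Hypothesis GS : forall t, G t `<=` G t.+1.
Variables (Y : nat -> T -> R) (delta : R).
Hypothesis mY : forall t, measurable_fun setT (Y t.+1 : g_sigma_algebraType (G t.+1) -> R).
Hypothesis YE : forall t (H : T -> R) M,
  measurable_fun setT (H : g_sigma_algebraType (G t) -> R) ->
  (forall w, 0 <= H w <= M) ->
  (\int[P]_w (H w * expR (Y t.+1 w))%:E <= \int[P]_w (H w)%:E)%E.
Hypothesis delta0 : 0 < delta.

(* The exponential supermartingale, stopped when it first exceeds [1 / delta]. *)
Let W := fix W (t : nat) (w : T) : R :=
  if t is t'.+1 then
    if W t' w <= delta^-1 then W t' w * expR (Y t w) else W t' w
  else 1.

Let W_gt0 t w : 0 < W t w.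
Proof.
elim: t => [|t IH] //=.
by case: ifP => // _; rewrite mulr_gt0// expR_gt0.
Qed.

Let mW t : measurable_fun setT (W t : g_sigma_algebraType (G t) -> R).
Proof.
elim: t => [|t IH] /=; first exact: measurable_cst.
have mWt := measurable_fun_sub_sigma_algebra (@GS t) IH.
apply: measurable_fun_ifT => //.
- by apply: measurable_fun_ler => //.
- by apply: measurable_funM => //; exact: measurableT_comp.
Qed.

Let mWT t : measurable_fun setT (W t).
Proof. exact: (sub_measurable_fun (@GT t) (@mW t)). Qed.

Let mYT t : measurable_fun setT (Y t.+1).
Proof. exact: (sub_measurable_fun (@GT t.+1) (@mY t)). Qed.

Let integral_W_le1 t : (\int[P]_w (W t w)%:E <= 1)%E.
Proof.
elim: t => [|t IH] /=.
  rewrite (_ : \int[P]_w _ = 1)%E//.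
  transitivity (1 * P setT)%E; first exact: (integral_cst P measurableT 1%E).
  by rewrite probability_setT mul1e.
apply: le_trans IH.
pose H w := if W t w <= delta^-1 then W t w else 0.
pose H' w := if W t w <= delta^-1 then 0 else W t w.
have mH : measurable_fun setT (H : g_sigma_algebraType (G t) -> R).
  by apply: measurable_fun_ifT => //; exact: measurable_fun_ler.
have mH' : measurable_fun setT H'.
  by apply: measurable_fun_ifT => //; exact: measurable_fun_ler.
have H0 w : 0 <= H w <= delta^-1.
  rewrite /H; case: ifPn => [->|_]; first by rewrite ltW.
  by rewrite lexx invr_ge0 ltW.
have H'0 w : 0 <= H' w by rewrite /H'; case: ifPn => // _; rewrite ltW.
have mHT := sub_measurable_fun (@GT t) mH.
have mHe : measurable_fun setT (fun w => H w * expR (Y t.+1 w)).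
  by apply: measurable_funM => //; exact: measurableT_comp.
rewrite (_ : (\int[P]_w _ = \int[P]_w ((H w * expR (Y t.+1 w))%:E + (H' w)%:E))%E); last first.
  apply: eq_integral => w _; rewrite -EFinD /H /H'.
  by case: ifPn => _; rewrite ?addr0// mul0r add0r.
rewrite [leRHS](_ : _ = (\int[P]_w ((H w)%:E + (H' w)%:E))%E); last first.
  apply: eq_integral => w _; rewrite -EFinD /H /H'.
  by case: ifPn => _; rewrite ?addr0// add0r.
have H00 w : 0 <= H w by case/andP: (H0 w).
rewrite !ge0_integralD//.
  by apply: leeD => //; exact: YE mH H0.
all: by [exact/measurable_EFinP | move=> w _; rewrite lee_fin ?mulr_ge0 ?expR_ge0].
Qed.

Let S t := [set w | delta^-1 < W t w].

Let mS t : measurable (S t).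
Proof.
have := @measurable_lt_cst _ _ _ (fun w => - W t w) (- delta^-1).
rewrite (_ : [set w | _] = S t).
  by apply; exact: measurableT_comp.
by apply/seteqP; split => w /=; rewrite ltrN2.
Qed.

Let PS t : (P (S t) <= delta%:E)%E.
Proof.
have : ((delta^-1)%:E * P (S t) <= 1)%E.
  apply: le_trans (integral_W_le1 t).
  rewrite -(setIT (S t)) -integral_indic// -ge0_integralZl_EFin//; last 2 first.
  - exact/measurable_EFinP.
  - by rewrite invr_ge0 ltW.
  apply: ge0_le_integral => //.
  - by move=> w _; rewrite lee_fin mulr_ge0// invr_ge0 ltW.
  - by apply/measurable_EFinP; apply: measurable_funM.
  - exact/measurable_EFinP.
  - move=> w _; rewrite lee_fin indicE; case: (boolP (w \in S t)) => [/set_mem|_].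
      by rewrite mulr1 => /ltW.
    by rewrite mulr0 ltW.
by rewrite lee_pdivrMl// mule1.
Qed.

Let ndS : nondecreasing_seq S.
Proof.
apply/nondecreasing_seqP => t; apply/subsetPset => w; rewrite /S/= => h.
by rewrite leNgt h.
Qed.

(** A frozen process stays above the level, so the sets [S t] increase and Markov's bound at each
    [t] passes to their union. Off the union nothing is ever frozen, and [W t] is the exponential of
    the whole sum. *)
Lemma ville_inequality : exists E : set T,
  [/\ measurable E, ((1 - delta)%:E <= P E)%E &
    forall w, E w -> forall t, \sum_(1 <= s < t.+1) Y s w <= ln delta^-1].
Proof.
have mU : measurable (\bigcup_t S t) by exact: bigcupT_measurable.
exists (~` \bigcup_t S t); split.
- exact: measurableC.
- rewrite probability_setC// EFinB; apply: leeB => //.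
  apply: (cvge_le _ (nondecreasing_cvg_mu mS mU ndS)).
  by apply: nearW => t; exact: PS.
- move=> w Sw t.
  have WS s : W s w <= delta^-1.
    by rewrite leNgt; apply/negP => h; apply: Sw; exists s.
  have WE s : W s w = expR (\sum_(1 <= r < s.+1) Y r w).
    elim: s => [|s IH] /=; first by rewrite big_geq// expR0.
    by rewrite WS IH -expRD [in RHS]big_nat_recr.
  rewrite -(expRK (\sum_(1 <= s < t.+1) Y s w)) -WE ler_ln ?posrE ?invr_gt0//.
Qed.

End ville.

(** * Step sizes *)

(** For [t >= 1] this is [alpha t * lambda t], because the minimum in [alpha] is [1 / lambda t]. It
    bounds the length of one mirror step. *)
Definition eta (R : realType) (gamma kappa mu : R) (t : nat) : R :=
  ((1 + ln (t%:R)) `^ gamma * (t%:R) `^ (kappa - mu))^-1.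

Section step_sizes.
Context {R : realType} (gamma kappa mu K : R).
Hypotheses (gamma0 : 0 <= gamma) (mukappa : mu <= kappa) (mu0 : 0 <= mu) (K0 : 0 < K).
Local Notation eta := (eta gamma kappa mu).
Local Notation alpha := (alpha gamma kappa mu K).
Local Notation lambda := (lambda mu K).

Let ln_nat (t : nat) : (1 <= t)%N -> 0 <= ln (t%:R : R).
Proof. by move=> t1; rewrite ln_ge0// ler1n. Qed.

Lemma eta_gt0 t : (1 <= t)%N -> 0 < eta t.
Proof.
move=> t1; have := ln_nat t1 => l0.
by rewrite invr_gt0 mulr_gt0// powR_gt0// ?ltr0n//; lra.
Qed.

Lemma eta1 : eta 1 = 1.
Proof. by rewrite /eta ln1 addr0 !powR1 mulr1 invr1. Qed.

Lemma eta_nonincreasing s t : (1 <= s)%N -> (s <= t)%N -> eta t <= eta s.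
Proof.
move=> s1 st; have t1 := leq_trans s1 st.
have [ls lt] := (ln_nat s1, ln_nat t1).
have lst : ln (s%:R : R) <= ln t%:R by rewrite ler_ln ?posrE ?ltr0n// ler_nat.
rewrite lef_pV2 ?posrE ?mulr_gt0 ?powR_gt0 ?ltr0n//; try lra.
rewrite ler_pM ?powR_ge0// ge0_ler_powR ?nnegrE ?ler0n ?ler_nat ?subr_ge0//; lra.
Qed.

Lemma eta_le1 t : (1 <= t)%N -> eta t <= 1.
Proof. by move=> t1; rewrite -eta1 eta_nonincreasing. Qed.

Lemma lambda_ge t : K <= lambda t.
Proof. by rewrite le_max lexx orbT. Qed.

Lemma lambda_gt0 t : 0 < lambda t.
Proof. exact: lt_le_trans (lambda_ge t). Qed.

Lemma lambda_nondecreasing s t : (s <= t)%N -> lambda s <= lambda t.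
Proof.
move=> st; rewrite /lambda ge_max !le_max lexx orbT andbT.
by rewrite ge0_ler_powR ?nnegrE ?ler_nat.
Qed.

Lemma alphaE t : (1 <= t)%N -> alpha t = eta t / lambda t.
Proof.
move=> t1; congr (_ * _); rewrite /lambda.
have tp : 0 < (t%:R : R) `^ mu by rewrite powR_gt0// ltr0n.
have [h|h] := leP (t%:R `^ mu) K.
  by rewrite min_r// lef_pV2 ?posrE.
by rewrite min_l// lef_pV2 ?posrE// ltW.
Qed.

Lemma alpha_ge0 t : 0 <= alpha t.
Proof.
by rewrite mulr_ge0 ?invr_ge0 ?mulr_ge0 ?powR_ge0// le_min !invr_ge0 powR_ge0 ltW.
Qed.

Lemma alpha_gt0 t : (1 <= t)%N -> 0 < alpha t.
Proof. by move=> t1; rewrite alphaE// divr_gt0 ?eta_gt0 ?lambda_gt0. Qed.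

Lemma alpha_lambda t : (1 <= t)%N -> alpha t * lambda t = eta t.
Proof. by move=> t1; rewrite alphaE// divfK// gt_eqF// lambda_gt0. Qed.

Lemma alpha_nonincreasing s t : (1 <= s)%N -> (s <= t)%N -> alpha t <= alpha s.
Proof.
move=> s1 st; have t1 := leq_trans s1 st; rewrite !alphaE//.
apply: ler_pM.
- exact/ltW/eta_gt0.
- by rewrite invr_ge0 ltW ?lambda_gt0.
- exact: eta_nonincreasing.
- by rewrite lef_pV2 ?posrE ?lambda_gt0 ?lambda_nondecreasing.
Qed.

End step_sizes.

(** * Last communication instant and partial sums of the series in [A] *)

Lemma tau_gt0 Pc t : (0 < tau Pc t)%N.
Proof.
rewrite /tau; case: ifP => // h.
have h1 : (1 < t.+1)%N by lia.
apply: leq_trans (leq_bigmax_cond (Ordinal h1) _) => //=.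
by rewrite mul1n ltnW.
Qed.

(* [1 + (t.-1 %/ Pc) * Pc] is the last instant of the form [1 + k Pc] up to [t]. *)
Lemma tau_le Pc t : (0 < Pc)%N -> (1 <= t)%N ->
  (tau Pc t <= 1 + (t.-1 %/ Pc) * Pc)%N.
Proof.
move=> P0 t1; rewrite /tau; case: ifP => // h.
apply/bigmax_leqP => k /andP[_ kt].
rewrite leq_add2l leq_mul2r leq_divRL//; apply/orP; right.
by rewrite -ltnS prednK.
Qed.

Lemma tau_le_id Pc t : (0 < Pc)%N -> (1 <= t)%N -> (tau Pc t <= t)%N.
Proof.
move=> P0 t1; apply: leq_trans (tau_le P0 t1) _.
by have := leq_divM t.-1 Pc; lia.
Qed.

Lemma series1_ge (R : realType) (c : nat -> R) T : (forall t, 0 <= c t) ->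
  ((\sum_(1 <= t < T.+1) c t)%:E <= series1 c)%E.
Proof.
move=> c0; rewrite -sumEFin; apply: nneseries_lim_ge => t _ _.
by rewrite lee_fin.
Qed.

(** Series of nonnegative terms dominate their partial sums. The comparison is made in the extended
    reals and, [A] being real, descends to a real inequality uniform in [T]. *)
Lemma Aexpr_ge (R : realType) (m Pc : nat) (L delta sigma p A : R) (al la : nat -> R) T :
  0 < L -> (forall t, 0 <= al t) -> (forall t, 0 <= la t) ->
  A%:E = Aexpr m Pc L delta sigma p al la ->
  ln delta^-1
  + 2 * m%:R * Pc%:R * (\sum_(1 <= t < T.+1) al t * al (tau Pc t) * la t * la (tau Pc t))
  + 4 * sigma `^ p * (\sum_(1 <= t < T.+1) al t * la t `^ (1 - p))
  + 40 * m%:R * sigma `^ p * (1 + 3 * m%:R) *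
     (\sum_(1 <= t < T.+1) (al t * la t) ^+ 2 * la t `^ (- p)) <= A.
Proof.
move=> L0 al0 la0 AE; rewrite -lee_fin AE /Aexpr.
have s0 (c : nat -> R) : (forall t, 0 <= c t) -> (0 <= series1 c)%E.
  by move=> c0; apply: nneseries_ge0 => t _ _; rewrite lee_fin.
rewrite -[leLHS]adde0; apply: leeD; last by rewrite lee_fin mulr_ge0.
rewrite -[leLHS]adde0; apply: leeD; last first.
  rewrite mule_ge0 ?lee_fin ?mulr_ge0 ?sqr_ge0 ?powR_ge0// s0// => t.
  by rewrite mulr_ge0 ?powR_ge0// exprn_ge0// mulr_ge0.
rewrite !EFinD; apply: leeD; last first.
  rewrite [leLHS]EFinM lee_wpmul2l ?lee_fin ?mulr_ge0 ?powR_ge0 ?addr_ge0//.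
  by apply: series1_ge => t; rewrite mulr_ge0 ?powR_ge0// exprn_ge0// mulr_ge0.
rewrite -[leLHS]adde0; apply: leeD; last first.
  rewrite mule_ge0 ?lee_fin ?mulr_ge0 ?powR_ge0// s0// => t.
  by rewrite mulr_ge0 ?powR_ge0// exprn_ge0.
apply: leeD; last first.
  rewrite [leLHS]EFinM lee_wpmul2l ?lee_fin ?mulr_ge0 ?powR_ge0//.
  by apply: series1_ge => t; rewrite mulr_ge0 ?powR_ge0.
apply: leeD; last first.
  rewrite [leLHS]EFinM lee_wpmul2l ?lee_fin ?mulr_ge0//.
  by apply: series1_ge => t; rewrite !mulr_ge0.
rewrite -[leLHS]adde0; apply: leeD => //.
rewrite mule_ge0 ?lee_fin ?mulr_ge0 ?sqr_ge0 ?(ltW L0)// s0// => t.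
by rewrite !mulr_ge0 ?sqr_ge0.
Qed.

(** * Adaptedness of the iterates *)

Lemma convex_set_mean_ord (R : realType) (n m : nat) (X : set 'rV[R]_n)
    (F : 'I_m -> 'rV[R]_n) :
  (0 < m)%N -> convex_set X -> (forall i, X (F i)) -> X (m%:R^-1 *: \sum_(j < m) F j).
Proof.
move=> m0 cX XF; have := size_enum_ord m; rewrite -big_enum/=.
case: (enum 'I_m) => [|i s] /= sz; first by rewrite -sz in m0.
by have := convex_set_mean i s cX XF; rewrite /= sz.
Qed.

Section adapted.
Context {R : realType} {n : nat}.
Variables (X : set 'rV[R]_n) (Phi : 'rV[R]_n -> R) (gradPhi : 'rV[R]_n -> 'rV[R]_n).
Hypotheses (X0 : X !=set0) (cX : convex_set X).
Hypothesis gP : forall z, X z -> has_gradient_at Phi gradPhi z.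
Hypothesis sP : forall z z', X z -> X z' ->
  Phi z - Phi z' >= dotv (gradPhi z') (z - z') + 2^-1 * enorm (z - z') ^+ 2.

Section one_sigma_algebra.
Context {d : measure_display} {T : measurableType d}.

Lemma measurable_lipschitz_comp (g : 'rV[R]_n -> R) (u : T -> 'rV[R]_n) (L : R) :
  (forall k, measurable_fun setT (fun w => u w 0 k)) -> (forall w, X (u w)) ->
  0 < L -> (forall z z', X z -> X z' -> `|g z - g z'| <= L * enorm (z - z')) ->
  measurable_fun setT (g \o u).
Proof.
move=> mu Xu L0 Lg; have [D XD dD] := dense_sequence X0.
apply: (measurable_continuous_comp dD mu Xu) => z Xz e e0.
exists (e / L); first by rewrite divr_gt0.
move=> z' Xz' zz; apply: le_lt_trans (Lg _ _ Xz' Xz) _.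
by rewrite mulrC -ltr_pdivlMr.
Qed.

(** Measurability of [gradPhi] is not given. The term [dotv (gradPhi (u w)) (z - u w)] is the limit
    of difference quotients of [Phi] along the segment from [u w] to [z], which lies in [X], where
    [Phi] is continuous. *)
Lemma measurable_bregman (u : T -> 'rV[R]_n) z :
  (forall k, measurable_fun setT (fun w => u w 0 k)) -> (forall w, X (u w)) -> X z ->
  measurable_fun setT (fun w => bregman Phi gradPhi z (u w)).
Proof.
move=> mu Xu Xz; have [D XD dD] := dense_sequence X0.
have mPhi (v : T -> 'rV[R]_n) : (forall k, measurable_fun setT (fun w => v w 0 k)) -> (forall w, X (v w)) ->
    measurable_fun setT (Phi \o v).
  move=> mv Xv; apply: (measurable_continuous_comp dD mv Xv) => z' Xz' e e0.
  by have [r r0 Hr] := has_gradient_continuous (gP Xz') e0; exists r => // z'' _ /Hr.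
apply: measurable_funB; first by apply: measurable_funB => //; exact: mPhi.
pose s N : R := N.+1%:R^-1.
have s0 N : 0 < s N by rewrite invr_gt0.
have s1 N : s N <= 1 by rewrite invf_le1// ler1n.
pose q N w := (s N)^-1 * (Phi (u w + s N *: (z - u w)) - Phi (u w)).
apply: (@measurable_fun_cvg _ _ _ _ q) => [N|w _].
  apply: measurable_funM => //; apply: measurable_funB; last exact: mPhi.
  apply: (mPhi (fun w => u w + s N *: (z - u w))) => [k|w].
    under eq_fun do rewrite !mxE.
    by apply: measurable_funD => //; apply: measurable_funM => //; exact: measurable_funB.
  by apply: convex_set_segment => //; rewrite ltW ?s0 ?s1.
apply/cvgrPdist_le => e e0.
have [r r0 Hr] := has_gradient_quotient (z - u w) (gP (Xu w)) e0.
near=> N.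
have sN : s N < r by near: N; exact: near_infty_natSinv_lt (PosNum r0).
have := Hr (s N); rewrite s0 sN => /(_ isT) h.
rewrite distrC /q -(mulKf (lt0r_neq0 (s0 N)) (dotv _ _)) -mulrBr normrM.
by rewrite gtr0_norm ?invr_gt0 ?s0// ler_pdivrMl ?s0.
Unshelve. all: by end_near. Qed.

(* [gradPhi] may be discontinuous on the boundary of [X], hence so may be the
   minimizer as a function of [u]. *)
Lemma measurable_mirror_step (al : R) (g u v : T -> 'rV[R]_n) k : 0 < al ->
  (forall j, measurable_fun setT (fun w => g w 0 j)) ->
  (forall j, measurable_fun setT (fun w => u w 0 j)) ->
  (forall w, X (u w)) -> (forall w, X (v w)) ->
  (forall w z, X z -> dotv (g w) (v w) + al^-1 * bregman Phi gradPhi (v w) (u w) <=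
                      dotv (g w) z + al^-1 * bregman Phi gradPhi z (u w)) ->
  measurable_fun setT (fun w => v w 0 k).
Proof.
move=> al0 mg mu Xu Xv vmin; have [D XD dD] := dense_sequence X0.
(* The objective is scaled by [al] so that it grows at least like half the squared distance to its
   minimizer. *)
pose h w z := al * dotv (g w) z + bregman Phi gradPhi z (u w).
apply: (@measurable_argmin _ _ _ _ X D XD dD v h) => //.
- move=> j; apply: measurable_funD; last exact: measurable_bregman.
  by apply: measurable_funM => //; exact: measurable_dotv.
- move=> w z Xz; have := mirror_step_le cX al0 (Xv w) Xz (gP (Xv w)) (vmin w).
  by have := bregman_ge (sP Xz (Xv w)); rewrite /h dotvBr; lra.
- move=> w e e0.
  have e20 : 0 < e / 2 by rewrite divr_gt0.
  have [r r0 Hr] := has_gradient_continuous (gP (Xv w)) e20.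
  (* Up to a constant in [z], [h w z] is [Phi z + dotv G z], so continuity at [v w] reduces to that
     of [Phi]. The [+ 1] in [c] avoids a division by zero. *)
  pose G := al *: g w - gradPhi (u w).
  pose c := enorm G + 1.
  have c0 : 0 < c by have := enorm_ge0 G; rewrite /c; lra.
  exists (Num.min r (e / 2 / c)); first by rewrite lt_min r0 divr_gt0.
  move=> z Xz; rewrite lt_min => /andP[/Hr]; rewrite ltr_norml => /andP[_ h1].
  rewrite ltr_pdivlMr// => h2.
  have h3 : dotv G (z - v w) < e / 2.
    apply: le_lt_trans h2; apply: le_trans (dotv_le _ _) _.
    by rewrite mulrC ler_wpM2l ?enorm_ge0// /c lerDl.
  rewrite -subr_lt0.
  have -> : h w z - (h w (v w) + e) =
    (Phi z - Phi (v w)) + dotv G (z - v w) - e.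
    by rewrite /h /bregman /G dotvBl dotvZl !dotvBr; ring.
  lra.
Qed.

End one_sigma_algebra.

Section iterates.
Context {m : nat} {d : measure_display} {Omega : measurableType d}.
Variables (ghat x y : 'I_m -> nat -> Omega -> 'rV[R]_n) (x1 : 'I_m -> 'rV[R]_n).
Variables (Pc : nat) (al la : nat -> R).
Hypotheses (m0 : (0 < m)%N) (al0 : forall t, (1 <= t)%N -> 0 < al t).
Hypothesis mghat : forall i t (k : 'I_n), measurable_fun setT (fun w => ghat i t w 0 k).
Hypothesis Xx1 : forall i, X (x1 i).
Hypothesis x_init : forall i w, x i 1%N w = x1 i.
Hypothesis y_step : forall i t w, (1 <= t)%N ->
  X (y i t.+1 w) /\
  forall z, X z ->
    dotv (clip (la t) (ghat i t w)) (y i t.+1 w)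
    + (al t)^-1 * bregman Phi gradPhi (y i t.+1 w) (x i t w)
    <= dotv (clip (la t) (ghat i t w)) z + (al t)^-1 * bregman Phi gradPhi z (x i t w).
Hypothesis x_comm : forall i t w, (1 <= t)%N -> comm_instant Pc t.+1 ->
  x i t.+1 w = (m%:R)^-1 *: \sum_(j < m) y j t.+1 w.
Hypothesis x_local : forall i t w, (1 <= t)%N -> ~ comm_instant Pc t.+1 ->
  x i t.+1 w = y i t.+1 w.

Lemma iterate_in i t w : (1 <= t)%N -> X (x i t w).
Proof.
case: t => // -[_|t _]; first by rewrite x_init.
have [c|c] := pselect (comm_instant Pc t.+2).
  by rewrite x_comm//; apply: convex_set_mean_ord => // j; have [] := @y_step j t.+1 w.
by rewrite x_local//; have [] := @y_step i t.+1 w.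
Qed.

Lemma Fgen_measurable t S : Fsig ghat t S -> measurable S.
Proof.
apply: smallest_sub; first exact: sigma_algebra_measurable.
move=> _ [i [s [k [B [_ mB ->]]]]].
by have := @mghat i s k measurableT B mB; rewrite setTI.
Qed.

Lemma Fgen_le s t : (s <= t)%N -> Fgen ghat s `<=` Fgen ghat t.
Proof.
move=> st S [i [r [k [B [/andP[r1 rs] mB ->]]]]].
by exists i, r, k, B; split => //; rewrite r1 (leq_trans rs).
Qed.

Lemma adapted_ghat i s t k : (1 <= s <= t)%N ->
  measurable_fun setT ((fun w => ghat i s w 0 k) : g_sigma_algebraType (Fgen ghat t) -> R).
Proof.
move=> st _ B mB; rewrite setTI; apply: sub_sigma_algebra.
by exists i, s, k, B.
Qed.

(** The index [t.-1] is what allows functions of [x i t] as weights in (A1). The induction treats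
    all agents at once, since averaging mixes them. *)
Lemma adapted_iterate i t k : (1 <= t)%N ->
  measurable_fun setT ((fun w => x i t w 0 k) : g_sigma_algebraType (Fgen ghat t.-1) -> R).
Proof.
elim: t i k => // -[_ i k _|t IH i k _].
  by under eq_fun do rewrite x_init; exact: measurable_cst.
have {}IH j l := measurable_fun_sub_sigma_algebra (Fgen_le (leqnSn t)) (IH j l isT).
have my j l : measurable_fun setT
    ((fun w => y j t.+2 w 0 l) : g_sigma_algebraType (Fgen ghat t.+1) -> R).
  apply: (@measurable_mirror_step _ (g_sigma_algebraType (Fgen ghat t.+1)) (al t.+1)
    (fun w => clip (la t.+1) (ghat j t.+1 w)) (x j t.+1)).
  - exact: al0.
  - by move=> r; apply: measurable_clip => r'; apply: adapted_ghat; rewrite leqnn.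
  - by move=> r; exact: IH.
  - by move=> w; exact: iterate_in.
  - by move=> w; have [] := @y_step j t.+1 w.
  - by move=> w; have [] := @y_step j t.+1 w.
have [c|c] := pselect (comm_instant Pc t.+2).
  under eq_fun do rewrite x_comm// mxE summxE.
  by apply: measurable_funM => //; exact: measurable_sum.
by under eq_fun do rewrite x_local//; exact: my.
Qed.

End iterates.
End adapted.

(** * Noise *)

(** Cauchy-Schwarz against the all-ones vector. *)
Lemma sqr_sum_le (R : realType) (m : nat) (a : 'I_m -> R) :
  (\sum_i a i) ^+ 2 <= m%:R * \sum_i a i ^+ 2.
Proof.
pose u := \row_i a i; pose v : 'rV[R]_m := const_mx 1.
have := norm_dotv_le u v; rewrite -(ler_pXn2r (ltn0Sn 1)) ?nnegrE ?mulr_ge0 ?enorm_ge0//.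
rewrite exprMn !sqr_enorm -normrX ger0_norm ?sqr_ge0//.
have -> : dotv u v = \sum_i a i by apply: eq_bigr => i _; rewrite !mxE mulr1.
have -> : dotv u u = \sum_i a i ^+ 2 by apply: eq_bigr => i _; rewrite !mxE expr2.
have -> : dotv v v = m%:R.
  rewrite (_ : m%:R = \sum_(i < m) 1); last by rewrite sumr_const card_ord.
  by apply: eq_bigr => i _; rewrite !mxE mulr1.
by rewrite mulrC.
Qed.

(** [expR_le_1Dx2] is applied to the sum over agents, which [small] keeps below [1 / 2]. The linear
    part leaves the centered term and the clipping bias; the quadratic part costs [2 * m * 9], from
    [sqr_sum_le] and [sqr_enorm_clipB_le]. An agent with [b i = 0] contributes nothing, so its
    gradient may be large. *)
Lemma expR_clip_noise_le (R : realType) (m n : nat) (lam bet p : R)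
    (g h b : 'I_m -> 'rV[R]_n) :
  1 < p <= 2 -> 0 < lam -> 0 <= bet -> m%:R * (3 / 2 * lam * bet) <= 2^-1 ->
  (forall i, b i = 0 \/ enorm (g i) <= lam / 2 /\ enorm (b i) <= bet) ->
  expR (\sum_i dotv (clip lam (h i) - g i) (b i)) <=
  1 + \sum_i dotv (h i - g i) (b i) +
  (2 * bet * lam `^ (1 - p) + 18 * m%:R * bet ^+ 2 * lam `^ (2 - p)) *
  \sum_i enorm (h i - g i) `^ p.
Proof.
move=> p12 l0 b0 small gb.
set S := \sum_i enorm _ `^ p.
pose e i := dotv (clip lam (h i) - g i) (b i).
have e1 i : e i <= 3 / 2 * lam * bet.
  rewrite /e; have [->|[gi bi]] := gb i; first by rewrite dotv0r !mulr_ge0// ltW.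
  apply: le_trans (dotv_le _ _) _; rewrite ler_pM ?enorm_ge0//.
  exact: enorm_clipB_le_lam (ltW l0) gi.
have e2 i : e i <= dotv (h i - g i) (b i)
    + 2 * bet * lam `^ (1 - p) * enorm (h i - g i) `^ p.
  rewrite /e; have [->|[gi bi]] := gb i; first by rewrite !dotv0r add0r !mulr_ge0 ?powR_ge0.
  rewrite (_ : clip lam (h i) - g i = (h i - g i) + (clip lam (h i) - h i)); last first.
    by apply/rowP => k; rewrite !mxE; ring.
  rewrite dotvDl lerD2l.
  apply: le_trans (dotv_le _ _) _.
  rewrite (_ : 2 * _ * _ * _ = (2 * lam `^ (1 - p) * enorm (h i - g i) `^ p) * bet); last by ring.
  by rewrite ler_pM ?enorm_ge0//; exact: enorm_clipB_le.
have e3 i : e i ^+ 2 <= 9 * bet ^+ 2 * lam `^ (2 - p) * enorm (h i - g i) `^ p.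
  rewrite /e; have [->|[gi bi]] := gb i.
    by rewrite dotv0r expr0n/= !mulr_ge0 ?powR_ge0 ?sqr_ge0.
  rewrite -[e in e <= _]ger0_norm ?sqr_ge0// normrX.
  apply: (@le_trans _ _ ((enorm (clip lam (h i) - g i) * enorm (b i)) ^+ 2)).
    by rewrite ler_pXn2r ?nnegrE ?mulr_ge0 ?enorm_ge0// norm_dotv_le.
  rewrite (_ : 9 * _ * _ * _ = (9 * lam `^ (2 - p) * enorm (h i - g i) `^ p) * bet ^+ 2); last by ring.
  rewrite exprMn ler_pM ?sqr_ge0//; first exact: sqr_enorm_clipB_le.
  by rewrite ler_pXn2r ?nnegrE ?enorm_ge0.
have sum1 : \sum_i e i <= 2^-1.
  apply: le_trans small; apply: (@le_trans _ _ (\sum_(i < m) (3 / 2 * lam * bet))).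
    exact: ler_sum.
  by rewrite sumr_const card_ord [m%:R * _]mulr_natl.
have sum2 : \sum_i e i <= \sum_i dotv (h i - g i) (b i) + 2 * bet * lam `^ (1 - p) * S.
  by rewrite mulr_sumr -big_split; exact: ler_sum.
have sum3 : (\sum_i e i) ^+ 2 <= m%:R * (9 * bet ^+ 2 * lam `^ (2 - p) * S).
  apply: le_trans (sqr_sum_le _) _; rewrite ler_wpM2l// mulr_sumr.
  exact: ler_sum.
have := expR_le_1Dx2 sum1; move: sum2 sum3; rewrite /e; lra.
Qed.

Section noise.
Context {R : realType} {m n : nat} {d : measure_display} {Omega : measurableType d}.
Variables (P : probability Omega R) (X : set 'rV[R]_n) (gradf : 'I_m -> 'rV[R]_n -> 'rV[R]_n).
Variables (ghat x : 'I_m -> nat -> Omega -> 'rV[R]_n) (xstar : 'rV[R]_n).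
Variables (al la : nat -> R) (p sigma L Gr : R).
Hypotheses (m0 : (0 < m)%N) (X0 : X !=set0) (p12 : 1 < p <= 2) (L0 : 0 < L) (Gr0 : 0 < Gr).
Hypotheses (al0 : forall t, (1 <= t)%N -> 0 < al t) (la0 : forall t, (1 <= t)%N -> 0 < la t).
Hypothesis alla1 : forall t, (1 <= t)%N -> al t * la t <= 1.
Hypothesis mghat : forall i t (k : 'I_n), measurable_fun setT (fun w => ghat i t w 0 k).
Hypothesis adx : forall i t k, (1 <= t)%N ->
  measurable_fun setT ((fun w => x i t w 0 k) : g_sigma_algebraType (Fgen ghat t.-1) -> R).
Hypothesis Xx : forall i t w, (1 <= t)%N -> X (x i t w).
Hypothesis gradL : forall i u v, X u -> X v ->
  enorm (gradf i u - gradf i v) <= L * enorm (u - v).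
Hypothesis A1 : forall i t, (1 <= t)%N -> forall S, Fsig ghat t.-1 S ->
  (\int[P]_(w in S) ((enorm (ghat i t w - gradf i (x i t w))) `^ p)%:E
     <= (sigma `^ p)%:E * P S)%E /\
  (forall k : 'I_n,
     (\int[P]_(w in S) ((ghat i t w - gradf i (x i t w)) 0 k)%:E = 0)%E).
Hypothesis grad_small : forall i t w, (1 <= t)%N -> enorm (x i t w - xstar) <= Gr ->
  enorm (gradf i (x i t w)) <= la t / 2.

(* The scale [1 / (3 m Gr)] keeps the exponent [noise t] below [1 / 2]. *)
Definition trunc_dir (i : 'I_m) (t : nat) (w : Omega) : 'rV[R]_n :=
  if enorm (x i t w - xstar) <= Gr then - (al t / (3 * m%:R * Gr)) *: (x i t w - xstar)
  else 0.

(** Multiplied by [3 * m * Gr], this is the error of using clipped samples instead of gradients in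
    the descent inequality, for the agents inside the ball. *)
Definition noise (t : nat) (w : Omega) : R :=
  \sum_i dotv (clip (la t) (ghat i t w) - gradf i (x i t w)) (trunc_dir i t w).

Let bet (t : nat) := al t / (3 * m%:R).

(** The coefficient of the [p]-th powers in [expR_clip_noise_le], at [lam = la t] and
    [bet = al t / (3 * m)]. *)
Definition noise_rate (t : nat) : R :=
  2 * (al t / (3 * m%:R)) * la t `^ (1 - p) +
  18 * m%:R * (al t / (3 * m%:R)) ^+ 2 * la t `^ (2 - p).

Let m0R : 0 < m%:R :> R. Proof. by rewrite ltr0n. Qed.

Let bet_ge0 t : (1 <= t)%N -> 0 <= bet t.
Proof. by move=> t1; rewrite divr_ge0 ?mulr_ge0 ?ltW ?al0. Qed.

Lemma noise_rate_ge0 t : (1 <= t)%N -> 0 <= noise_rate t.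
Proof.
move=> t1; have : 0 <= al t / (3 * m%:R) := bet_ge0 t1.
rewrite /noise_rate; move: (al t / _) => b b0.
by rewrite addr_ge0// !mulr_ge0 ?powR_ge0 ?sqr_ge0.
Qed.

Let enorm_trunc_dir i t w : (1 <= t)%N -> enorm (trunc_dir i t w) <= bet t.
Proof.
move=> t1; rewrite /trunc_dir; case: ifPn => h; last by rewrite enorm0 bet_ge0.
have a0 := al0 t1; rewrite scaleNr enormN enormZ ger0_norm; last first.
  by rewrite divr_ge0 ?mulr_ge0 ?(ltW a0) ?(ltW Gr0).
rewrite (_ : _ / _ * _ = bet t * (enorm (x i t w - xstar) / Gr)); last first.
  by rewrite /bet; field; rewrite !gt_eqF.
by rewrite ler_piMr ?bet_ge0// ler_pdivrMr// mul1r.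
Qed.

Let adapted_gradf i t k : (1 <= t)%N ->
  measurable_fun setT ((fun w => gradf i (x i t w) 0 k)
                       : g_sigma_algebraType (Fgen ghat t.-1) -> R).
Proof.
move=> t1; apply: (@measurable_lipschitz_comp R n X X0 _
  (g_sigma_algebraType (Fgen ghat t.-1)) (fun z => gradf i z 0 k) (x i t) L) => //.
- by move=> j; exact: adx.
- by move=> w; exact: Xx.
- move=> z z' Xz Xz'; apply: le_trans (gradL i Xz Xz').
  by have := coord_le_enorm (gradf i z - gradf i z') k; rewrite !mxE.
Qed.

Let adapted_trunc_dir i t k : (1 <= t)%N ->
  measurable_fun setT ((fun w => trunc_dir i t w 0 k)
                       : g_sigma_algebraType (Fgen ghat t.-1) -> R).
Proof.
move=> t1; have mx j : measurable_fun setT ((fun w => (x i t w - xstar) 0 j)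
    : g_sigma_algebraType (Fgen ghat t.-1) -> R).
  by apply: (@measurable_mxB R n _ (g_sigma_algebraType (Fgen ghat t.-1)) (x i t) (fun=> xstar));
    [exact: adx | exact: measurable_cst].
rewrite (_ : (fun w => _) = (fun w => if enorm (x i t w - xstar) <= Gr
   then - (al t / (3 * m%:R * Gr)) * (x i t w - xstar) 0 k else 0)); last first.
  by apply/funext => w; rewrite /trunc_dir; case: ifP; rewrite mxE.
apply: measurable_fun_ifT => //; last exact: measurable_funM.
by apply: measurable_fun_ler => //; exact: measurable_enorm.
Qed.

Let G_measurable t S : <<s Fgen ghat t >> S -> measurable S.
Proof. exact: Fgen_measurable. Qed.

Let to_next t (h : Omega -> R) :
  measurable_fun setT (h : g_sigma_algebraType (Fgen ghat t) -> R) ->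
  measurable_fun setT (h : g_sigma_algebraType (Fgen ghat t.+1) -> R).
Proof. by apply: measurable_fun_sub_sigma_algebra; exact: Fgen_le. Qed.

Lemma adapted_noise t :
  measurable_fun setT (noise t.+1 : g_sigma_algebraType (Fgen ghat t.+1) -> R).
Proof.
apply: measurable_sum => i; apply: measurable_dotv => k; last first.
  by apply: to_next; exact: (@adapted_trunc_dir i t.+1).
apply: measurable_mxB; last by apply: to_next; exact: (@adapted_gradf i t.+1).
by apply: measurable_clip => j; apply: adapted_ghat; rewrite leqnn.
Qed.

Lemma integral_expR_noise_le t (H : Omega -> R) M :
  measurable_fun setT (H : g_sigma_algebraType (Fgen ghat t) -> R) ->
  (forall w, 0 <= H w <= M) ->
  (\int[P]_w (H w * expR (noise t.+1 w))%:E <=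
   (1 + m%:R * sigma `^ p * noise_rate t.+1)%:E * \int[P]_w (H w)%:E)%E.
Proof.
move=> mH HM.
have GT := @G_measurable t.
pose zeta i w := ghat i t.+1 w - gradf i (x i t.+1 w).
have mzeta i k : measurable_fun setT (fun w => zeta i w 0 k).
  apply: measurable_mxB; first exact: mghat.
  exact: (sub_measurable_fun GT (@adapted_gradf i t.+1 k isT)).
have mzp i : measurable_fun setT (fun w => enorm (zeta i w) `^ p).
  apply: measurableT_comp (measurable_powR _) _; apply: measurable_enorm => k.
  exact: mzeta.
have izp i : P.-integrable setT (EFin \o (fun w => enorm (zeta i w) `^ p)).
  apply/integrableP; split; first exact/measurable_EFinP.
  under eq_integral do rewrite /= ger0_norm ?powR_ge0//.
  have [|h _] := A1 i (ltn0Sn t) (S := setT); first exact: (@measurableT _ (g_sigma_algebraType (Fgen ghat t))).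
  by apply: le_lt_trans h _; rewrite probability_setT mule1 ltry.
(* As [p > 1], a coordinate is at most 1 plus the [p]-th power of the norm, so the moment bound
   gives integrability. *)
have iz i k : P.-integrable setT (EFin \o (fun w => zeta i w 0 k)).
  have i1 : P.-integrable setT (EFin \o (fun w => 1 + enorm (zeta i w) `^ p)).
    rewrite (_ : _ \o _ = (EFin \o cst 1) \+ (EFin \o (fun w => enorm (zeta i w) `^ p)))//.
    by apply: integrableD => //; exact: finite_measure_integrable_cst.
  apply: (le_integrable measurableT _ _ i1); first exact/measurable_EFinP.
  move=> w _ /=; rewrite lee_fin (le_trans (coord_le_enorm _ _))//.
  apply: le_trans (ler_norm _); have e0 := enorm_ge0 (zeta i w).
  have [h|h] := leP (enorm (zeta i w)) 1.
    by rewrite (le_trans h)// lerDl powR_ge0.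
  apply: (@le_trans _ _ (enorm (zeta i w) `^ p)); last by rewrite lerDr.
  by apply: le1r_powR; [exact: ltW|case/andP: p12 => /ltW].
have r0 := noise_rate_ge0 (ltn0Sn t).
pose q w := noise_rate t.+1 * \sum_i enorm (zeta i w) `^ p.
have q0 w : 0 <= q w by rewrite mulr_ge0// sumr_ge0// => i _; rewrite powR_ge0.
(* Centering in (A1) is by coordinates, hence one linear term per agent and coordinate. *)
pose J : finType := ('I_m * 'I_n)%type.
apply: (@integral_mul_le_of_linear_bound R d Omega P (Fgen ghat t) GT J
  (fun j w => trunc_dir j.1 t.+1 w 0 j.2) (fun j w => zeta j.1 w 0 j.2) q
  (fun w => expR (noise t.+1 w)) H _ (Num.max M (bet t.+1))) => //.
- by move=> [i k]; exact: (@adapted_trunc_dir i t.+1 k).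
- move=> [i k] w /=; apply: le_trans (coord_le_enorm _ _) _.
  by rewrite le_max enorm_trunc_dir// orbT.
- by move=> [i k] S GS /=; have [_ ->] := A1 i (ltn0Sn t) GS.
- have := @integrable_sum _ _ _ P setT measurableT _ (index_enum 'I_m) xpredT
    (fun i => EFin \o (fun w => enorm (zeta i w) `^ p)) (fun i _ => izp i).
  move=> /(integrableZl measurableT (noise_rate t.+1)).
  by congr (_.-integrable _ _); apply/funext => w; rewrite /= sumEFin.
- by rewrite !mulr_ge0 ?powR_ge0.
- move=> S GS; rewrite /q; have mS := GT S GS.
  under eq_integral do rewrite EFinM.
  rewrite ge0_integralZl_EFin//; last 2 first.
    by move=> w _; rewrite lee_fin sumr_ge0// => i _; rewrite powR_ge0.
    by apply/measurable_EFinP; apply/measurable_funTS/measurable_sum.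
  rewrite [m%:R * _ * _]mulrC EFinM -muleA; apply: lee_wpmul2l; first by rewrite lee_fin.
  under eq_integral do rewrite -sumEFin.
  rewrite ge0_integral_sum//; last 2 first.
    by move=> i; apply/measurable_EFinP/measurable_funTS.
    by move=> i w _; rewrite lee_fin powR_ge0.
  apply: (@le_trans _ _ (\sum_(i < m) ((sigma `^ p)%:E * P S))%E).
    by apply: lee_sum => i _; have [] := A1 i (ltn0Sn t) GS.
  by rewrite sumr_const card_ord EFinM -muleA mule_natl.
- apply: measurableT_comp => //.
  exact: (sub_measurable_fun (@G_measurable t.+1) (@adapted_noise t)).
- move=> w; rewrite expR_ge0/=.
  have -> : \sum_(j : J) trunc_dir j.1 t.+1 w 0 j.2 * zeta j.1 w 0 j.2 =
      \sum_i dotv (zeta i w) (trunc_dir i t.+1 w).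
    rewrite -(pair_bigA _ (fun i k => trunc_dir i t.+1 w 0 k * zeta i w 0 k))/=; apply: eq_bigr => i _.
    by apply: eq_bigr => k _; rewrite mulrC.
  apply: (@expR_clip_noise_le _ _ _ (la t.+1) (bet t.+1)) => //.
  + exact: la0.
  + exact: bet_ge0.
  + have := alla1 (ltn0Sn t); rewrite /bet => h.
    have -> : m%:R * (3 / 2 * la t.+1 * (al t.+1 / (3 * m%:R))) = (al t.+1 * la t.+1) / 2.
      by field; rewrite gt_eqF.
    lra.
  + move=> i; have [h|h] := leP (enorm (x i t.+1 w - xstar)) Gr.
      by right; split; [exact: grad_small | exact: enorm_trunc_dir].
    by left; rewrite /trunc_dir leNgt h.
- by move=> w; have /andP[-> h] := HM w; rewrite le_max h.
Qed.

(** By [1 + c <= expR c], the factor of the one-step bound becomes a deterministic compensator;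
    [noise] minus this compensator satisfies the hypothesis of Ville's inequality. *)
Lemma noise_bound delta : 0 < delta ->
  exists E : set Omega, [/\ measurable E, ((1 - delta)%:E <= P E)%E &
    forall w, E w -> forall T, \sum_(1 <= t < T.+1) noise t w <=
      ln delta^-1 + m%:R * sigma `^ p * \sum_(1 <= t < T.+1) noise_rate t].
Proof.
move=> delta0.
pose Y t w := noise t w - m%:R * sigma `^ p * noise_rate t.
have GS t : Fgen ghat t `<=` Fgen ghat t.+1 by exact: Fgen_le.
have mY t : measurable_fun setT (Y t.+1 : g_sigma_algebraType (Fgen ghat t.+1) -> R).
  by apply: measurable_funB; [exact: adapted_noise | exact: measurable_cst].
have [|E [mE PE EY]] := @ville_inequality R d Omega P _ G_measurable GS Y delta mY _ delta0.
  move=> t H M mH HM.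
  set c := m%:R * sigma `^ p * noise_rate t.+1.
  have c0 : 0 <= c by rewrite !mulr_ge0 ?powR_ge0 ?noise_rate_ge0.
  have H0 w : 0 <= H w by case/andP: (HM w).
  have mHT := sub_measurable_fun (@G_measurable t) mH.
  have mn := sub_measurable_fun (@G_measurable t.+1) (@adapted_noise t).
  have mHe : measurable_fun setT (fun w => H w * expR (noise t.+1 w)).
    by apply: measurable_funM => //; exact: measurableT_comp.
  rewrite (_ : (\int[P]_w _ = (expR (- c))%:E * \int[P]_w (H w * expR (noise t.+1 w))%:E)%E); last first.
    rewrite -ge0_integralZl_EFin ?expR_ge0//; last exact/measurable_EFinP.
      by apply: eq_integral => w _; rewrite /Y expRD mulrA [RHS]muleC.
    by move=> w _; rewrite lee_fin mulr_ge0 ?expR_ge0.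
  apply: le_trans (lee_wpmul2l _ (integral_expR_noise_le mH HM)) _.
    by rewrite lee_fin expR_ge0.
  rewrite muleA -EFinM -[leRHS]mul1e; apply: lee_wpmul2r.
    by apply: integral_ge0 => w _; rewrite lee_fin.
  rewrite lee_fin -/c; apply: (@le_trans _ _ (expR (- c) * expR c)).
    by rewrite ler_wpM2l ?expR_ge0// expR_ge1Dx.
  by rewrite -expRD addNr expR0.
exists E; split => // w Ew T; have := EY w Ew T.
by rewrite /Y sumrB -mulr_sumr; lra.
Qed.

End noise.

(** * The trajectory *)

Section trajectory.
Context {R : realType} {m n : nat}.
Variables (X : set 'rV[R]_n) (f : 'I_m -> 'rV[R]_n -> R) (gradf : 'I_m -> 'rV[R]_n -> 'rV[R]_n).
Variables (xstar : 'rV[R]_n) (Phi : 'rV[R]_n -> R) (gradPhi : 'rV[R]_n -> 'rV[R]_n).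
Variables (ghat x y : 'I_m -> nat -> 'rV[R]_n) (Pc : nat) (al la : nat -> R) (R1 Gr : R).
Hypotheses (m0 : (0 < m)%N) (Pc0 : (0 < Pc)%N) (cX : convex_set X).
Hypothesis cf : forall i, convex_function X (f i).
Hypothesis gf : forall i z, X z -> has_gradient_at (f i) (gradf i) z.
Hypothesis Xstar : X xstar.
Hypothesis fmin : forall z, X z -> \sum_(i < m) f i xstar <= \sum_(i < m) f i z.
Hypothesis gP : forall z, X z -> has_gradient_at Phi gradPhi z.
Hypothesis sP : forall u v, X u -> X v ->
  Phi u - Phi v >= dotv (gradPhi v) (u - v) + 2^-1 * (enorm (u - v)) ^+ 2.
Hypothesis A3 : forall (k : nat) (a : 'I_k -> R) (ys : 'I_k -> 'rV[R]_n) (z : 'rV[R]_n),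
  X z -> (forall j, X (ys j)) -> (forall j, 0 <= a j) -> \sum_(j < k) a j = 1 ->
  bregman Phi gradPhi z (\sum_(j < k) a j *: ys j)
    <= \sum_(j < k) a j * bregman Phi gradPhi z (ys j).
Hypotheses (al0 : forall t, (1 <= t)%N -> 0 < al t) (la0 : forall t, (1 <= t)%N -> 0 < la t).
Local Notation eta t := (al t * la t).
Hypothesis eta_noninc : forall s t, (1 <= s)%N -> (s <= t)%N -> eta t <= eta s.
Hypothesis R1_ge : forall i, Num.sqrt (2 * bregman Phi gradPhi xstar (x i 1%N)) <= R1.
Hypothesis Gr0 : 0 < Gr.
Hypothesis grad_small : forall i t z, (1 <= t)%N -> X z -> enorm (z - xstar) <= Gr ->
  enorm (gradf i z) <= la t / 2.
Hypothesis Xx : forall i t, (1 <= t)%N -> X (x i t).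
Hypothesis y_step : forall i t, (1 <= t)%N ->
  X (y i t.+1) /\
  forall z, X z ->
    dotv (clip (la t) (ghat i t)) (y i t.+1)
    + (al t)^-1 * bregman Phi gradPhi (y i t.+1) (x i t)
    <= dotv (clip (la t) (ghat i t)) z + (al t)^-1 * bregman Phi gradPhi z (x i t).
Hypothesis x_comm : forall i t, (1 <= t)%N -> comm_instant Pc t.+1 ->
  x i t.+1 = (m%:R)^-1 *: \sum_(j < m) y j t.+1.
Hypothesis x_local : forall i t, (1 <= t)%N -> ~ comm_instant Pc t.+1 ->
  x i t.+1 = y i t.+1.

Let S t := \sum_(i < m) bregman Phi gradPhi xstar (x i t).

Let m0R : 0 < m%:R :> R. Proof. by rewrite ltr0n. Qed.

Lemma dist_initial i : enorm (x i 1%N - xstar) <= R1.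
Proof. by apply: le_trans (R1_ge i); exact: dist_le_sqrt_bregman (sP Xstar (Xx i _)). Qed.

Lemma potential_initial : S 1 <= m%:R * R1 ^+ 2 / 2.
Proof.
rewrite /S (_ : m%:R * R1 ^+ 2 / 2 = \sum_(i < m) (R1 ^+ 2 / 2)); last first.
  by rewrite sumr_const card_ord -mulrA mulr_natl.
apply: ler_sum => i _.
have h := bregman_ge (sP Xstar (Xx i (leqnn 1))).
have b0 : 0 <= bregman Phi gradPhi xstar (x i 1%N).
  by apply: le_trans h; rewrite mulr_ge0 ?sqr_ge0.
have R10 : 0 <= R1 by apply: le_trans (R1_ge i); rewrite sqrtr_ge0.
have : Num.sqrt (2 * bregman Phi gradPhi xstar (x i 1%N)) ^+ 2 <= R1 ^+ 2.
  by rewrite ler_pXn2r ?nnegrE ?sqrtr_ge0// R1_ge.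
rewrite sqr_sqrtr ?mulr_ge0//; lra.
Qed.

Lemma dist_le_potential i t : (1 <= t)%N -> S t <= Gr ^+ 2 / 2 ->
  enorm (x i t - xstar) <= Gr.
Proof.
move=> t1 St; have Xxt j : X (x j t) by exact: Xx.
have b0 j : 0 <= bregman Phi gradPhi xstar (x j t).
  by apply: le_trans (bregman_ge (sP Xstar (Xxt j))); rewrite mulr_ge0 ?sqr_ge0.
apply: le_trans (dist_le_sqrt_bregman (sP Xstar (Xxt i))) _.
rewrite -(ler_pXn2r (ltn0Sn 1)) ?nnegrE ?sqrtr_ge0 ?(ltW Gr0)//.
rewrite [leLHS]sqr_sqrtr ?mulr_ge0//.
have : bregman Phi gradPhi xstar (x i t) <= S t.
  by rewrite /S (bigD1 i)//= lerDl sumr_ge0.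
lra.
Qed.

Lemma step_length i t : (1 <= t)%N -> enorm (y i t.+1 - x i t) <= eta t.
Proof.
move=> t1; have [Xy ymin] := y_step i t1.
apply: le_trans (mirror_step_dist cX (al0 t1) (Xx i t1) Xy gP sP ymin) _.
by rewrite ler_wpM2l ?(ltW (al0 t1))// enorm_clip// ltW ?la0.
Qed.

Lemma drift i c r : (1 <= c)%N ->
  (forall s, (c < s <= c + r)%N -> ~ comm_instant Pc s) ->
  enorm (x i (c + r)%N - x i c) <= r%:R * eta c.
Proof.
move=> c1; elim: r => [|r IH] nc; first by rewrite addn0 subrr enorm0 mul0r.
have cr1 : (1 <= c + r)%N by lia.
rewrite addnS x_local//; last by apply: nc; lia.
have h1 : enorm (x i (c + r)%N - x i c) <= r%:R * eta c.
  by apply: IH => s hs; apply: nc; lia.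
have h2 := step_length i cr1.
have h3 : eta (c + r)%N <= eta c by apply: eta_noninc => //; lia.
have := enorm_dist (x i (c + r)%N) (y i (c + r).+1) (x i c).
rewrite -natr1 mulrDl mul1r; lra.
Qed.

(** The agents agree at the last averaging time [c] and then each drifts for fewer than [Pc] steps,
    hence the factor 2. Before the first averaging, [c = 1] and the starting points lie within [R1]
    of [xstar], hence the extra [2 * R1]. *)
Lemma consensus i j t : (1 <= t)%N ->
  enorm (x i t - x j t) <= 2 * Pc%:R * eta (tau Pc t) + (if (t <= Pc)%N then 2 * R1 else 0).
Proof.
move=> t1; set q := (t.-1 %/ Pc)%N; set c := (1 + q * Pc)%N.
have ht : (t = c + t.-1 %% Pc)%N by have := divn_eq t.-1 Pc; rewrite /c /q; lia.
have hr := ltn_pmod t.-1 Pc0.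
have nc s : (c < s <= c + t.-1 %% Pc)%N -> ~ comm_instant Pc s.
  rewrite -ht => /andP[cs st] [k [k1 sk]].
  have : (k * Pc <= t.-1)%N by lia.
  by rewrite -leq_divRL// -/q -(leq_pmul2r Pc0); rewrite /c in cs; lia.
have c1 : (1 <= c)%N by rewrite /c; lia.
have e0 : 0 <= eta c by rewrite mulr_ge0// ltW ?al0 ?la0.
have d1 k : enorm (x k t - x k c) <= Pc%:R * eta c.
  rewrite ht; apply: le_trans (drift k c1 nc) _.
  by rewrite ler_wpM2r// ler_nat ltnW.
(* [tau Pc t] can precede [c]: at [t = 1 + Pc] it is still 1. Monotonicity of the step bound covers
   this. *)
have d2 : eta c <= eta (tau Pc t) by apply: eta_noninc; [exact: tau_gt0|exact: tau_le].
have d3 : Pc%:R * eta c <= Pc%:R * eta (tau Pc t) by rewrite ler_wpM2l.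
have d4 : enorm (x i c - x j c) <= if (t <= Pc)%N then 2 * R1 else 0.
  case: ifPn => tP.
    have -> : c = 1%N by rewrite /c /q divn_small//; lia.
    have := enorm_dist xstar (x i 1%N) (x j 1%N).
    have := dist_initial i; have := dist_initial j; rewrite (enormBC xstar); lra.
  have q1 : (1 <= q)%N by rewrite /q divn_gt0//; lia.
  have cE : c = (q * Pc).+1 by rewrite /c add1n.
  have qP : (1 <= q * Pc)%N by rewrite muln_gt0 q1.
  by rewrite cE !x_comm// ?subrr ?enorm0//; exists q; split => //; rewrite add1n.
have := enorm_dist (x i c) (x i t) (x j t).
have := enorm_dist (x j c) (x i c) (x j t).
have := d1 i; have := d1 j; rewrite (enormBC (x j t)); lra.
Qed.

(** Moving the linear term from [y] back to [x] costs [eta t] times the step length, strong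
    convexity returns half its square, and completing the square leaves [eta t ^ 2 / 2]. *)
Lemma agent_descent i t : (1 <= t)%N ->
  bregman Phi gradPhi xstar (y i t.+1) <= bregman Phi gradPhi xstar (x i t)
    - al t * dotv (clip (la t) (ghat i t)) (x i t - xstar) + eta t ^+ 2 / 2.
Proof.
move=> t1; have [Xy ymin] := y_step i t1; have at0 := al0 t1.
have := mirror_step_le cX at0 Xy Xstar (gP Xy) ymin.
have := bregman_ge (sP Xy (Xx i t1)).
set g := clip _ _; have gl : enorm g <= la t by rewrite enorm_clip// ltW ?la0.
have h1 : al t * dotv g (x i t - y i t.+1) <= eta t * enorm (y i t.+1 - x i t).
  rewrite -mulrA ler_pM2l//; apply: le_trans (dotv_le _ _) _.
  by rewrite enormBC ler_wpM2r// enorm_ge0.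
have h2 : 0 <= (eta t - enorm (y i t.+1 - x i t)) ^+ 2 by rewrite sqr_ge0.
have h3 : al t * dotv g (y i t.+1 - xstar) =
  al t * dotv g (x i t - xstar) - al t * dotv g (x i t - y i t.+1).
  by rewrite -mulrBr -dotvBr; congr (_ * dotv _ _); apply/rowP => k; rewrite !mxE; ring.
lra.
Qed.

Lemma potential_descent t : (1 <= t)%N ->
  S t.+1 <= S t - al t * (\sum_i dotv (clip (la t) (ghat i t)) (x i t - xstar))
            + m%:R / 2 * eta t ^+ 2.
Proof.
move=> t1; apply: (@le_trans _ _ (\sum_(i < m) bregman Phi gradPhi xstar (y i t.+1))).
  have [c|c] := pselect (comm_instant Pc t.+1); last first.
    by rewrite /S; apply: ler_sum => i _; rewrite x_local.
  have mi0 : 0 <= m%:R^-1 :> R by rewrite invr_ge0 ler0n.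
  have mn : \sum_(j < m) m%:R^-1 = 1 :> R.
    by rewrite sumr_const card_ord -[_ *+ m]mulr_natl divff// gt_eqF.
  have := @A3 m (fun=> m%:R^-1) (fun j => y j t.+1) xstar Xstar
    (fun j => (y_step j t1).1) (fun=> mi0) mn.
  rewrite -scaler_sumr -mulr_sumr => h.
  rewrite /S; under eq_bigr do rewrite x_comm//.
  rewrite sumr_const card_ord; move: h; set b := bregman _ _ _ (_ *: _) => h.
  by rewrite -[b *+ m]mulr_natl -[leRHS](mulVKf (lt0r_neq0 m0R)) ler_pM2l.
apply: (@le_trans _ _ (\sum_(i < m) (bregman Phi gradPhi xstar (x i t)
    - al t * dotv (clip (la t) (ghat i t)) (x i t - xstar) + eta t ^+ 2 / 2))).
  by apply: ler_sum => i _; exact: agent_descent.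
rewrite big_split sumrB/= -mulr_sumr sumr_const card_ord -[_ *+ m]mulr_natl.
by rewrite le_eqVlt; apply/orP; left; apply/eqP; rewrite /S; ring.
Qed.

(** Convexity of [f i] at [x i t] compares with [xstar]; convexity at [x l t] moves the value from
    agent [i] to agent [l], at the price of the gradient bound times the consensus distance. *)
Lemma regret_le l t : (1 <= t)%N -> enorm (x l t - xstar) <= Gr ->
  (\sum_i f i (x l t) - \sum_i f i xstar) - m%:R * (la t / 2) *
    (2 * Pc%:R * eta (tau Pc t) + (if (t <= Pc)%N then 2 * R1 else 0))
  <= \sum_i dotv (gradf i (x i t)) (x i t - xstar).
Proof.
move=> t1 xl; set D := 2 * _ * _ + _.
rewrite -sumrB (_ : m%:R * (la t / 2) * D = \sum_(i < m) (la t / 2 * D)); last first.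
  by rewrite sumr_const card_ord -mulrA mulr_natl.
rewrite -sumrB; apply: ler_sum => i _.
have h1 := convex_gradient_le (cf i) (gf i (Xx i t1)) (Xx i t1) Xstar.
have h2 := convex_gradient_le (cf i) (gf i (Xx l t1)) (Xx l t1) (Xx i t1).
have h3 := dotv_le (gradf i (x l t)) (x l t - x i t).
have h4 : enorm (gradf i (x l t)) * enorm (x l t - x i t) <= la t / 2 * D.
  by rewrite ler_pM ?enorm_ge0//; [exact: grad_small (Xx l t1) xl | exact: consensus].
rewrite -opprB dotvNr in h1; rewrite -opprB dotvNr in h2.
lra.
Qed.

(** Convertible to [noise t w] at the outcome under study, so the bound obtained from Ville's
    inequality applies to it directly. *)
Let nz t := \sum_i dotv (clip (la t) (ghat i t) - gradf i (x i t))
  (if enorm (x i t - xstar) <= Gr then - (al t / (3 * m%:R * Gr)) *: (x i t - xstar) else 0).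

(** In order: squared step lengths, drift since the last averaging, spread of the starting points
    during the first period. The last two are [al t] times the error in [regret_le]. *)
Let err t := m%:R / 2 * eta t ^+ 2 + m%:R * Pc%:R * (eta t * eta (tau Pc t))
  + (if (t <= Pc)%N then m%:R * R1 * eta t else 0).

Let gap l t := \sum_i f i (x l t) - \sum_i f i xstar.

Lemma potential_step l t : (1 <= t)%N -> S t <= Gr ^+ 2 / 2 ->
  S t.+1 + al t * gap l t <= S t + 3 * m%:R * Gr * nz t + err t.
Proof.
move=> t1 St.
have good i := dist_le_potential i t1 St.
have h1 := potential_descent t1; have h2 := regret_le t1 (good l).
have h3 : 3 * m%:R * Gr * nz t = - (al t *
   (\sum_i dotv (clip (la t) (ghat i t)) (x i t - xstar)
    - \sum_i dotv (gradf i (x i t)) (x i t - xstar))).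
  rewrite -sumrB !mulr_sumr -sumrN; apply: eq_bigr => i _.
  by rewrite good dotvZr dotvBl; field; rewrite !gt_eqF.
rewrite h3 -/(gap l t) in h2 *.
have := ler_wpM2l (ltW (al0 t1)) h2; rewrite /err.
case: ifP => _; lra.
Qed.

Lemma weighted_regret_le l N T :
  (forall T, \sum_(1 <= t < T.+1) nz t <= N) ->
  (forall T, m%:R * R1 ^+ 2 / 2 + 3 * m%:R * Gr * N + \sum_(1 <= t < T.+1) err t <= Gr ^+ 2 / 2) ->
  \sum_(1 <= t < T.+1) al t * gap l t <= Gr ^+ 2 / 2.
Proof.
move=> nzN budget.
have gap0 t : (1 <= t)%N -> 0 <= al t * gap l t.
  by move=> t1; rewrite mulr_ge0 ?(ltW (al0 t1))// subr_ge0 fmin//; exact: Xx.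
have sum_gap0 T' : 0 <= \sum_(1 <= t < T'.+1) al t * gap l t.
  by rewrite big_nat_cond sumr_ge0// => t /andP[/andP[t1 _] _]; exact: gap0.
have S0 t : (1 <= t)%N -> 0 <= S t.
  move=> t1; rewrite sumr_ge0// => i _.
  by apply: le_trans (bregman_ge (sP Xstar (Xx i t1))); rewrite mulr_ge0 ?sqr_ge0.
have c0 : 0 <= 3 * m%:R * Gr by rewrite !mulr_ge0// ltW.
(* The gaps being nonnegative, this inequality and the budget bound [S T'.+1] by [Gr ^ 2 / 2], which
   is the condition for [potential_step] at the next time. *)
suff main T' : S T'.+1 + \sum_(1 <= t < T'.+1) al t * gap l t <=
    S 1 + 3 * m%:R * Gr * (\sum_(1 <= t < T'.+1) nz t) + \sum_(1 <= t < T'.+1) err t.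
  have := main T; have := budget T; have := potential_initial.
  have := ler_wpM2l c0 (nzN T); have := S0 T.+1 isT; lra.
elim: T' => [|T' IH]; first by rewrite !big_geq// mulr0 !addr0.
have ST : S T'.+1 <= Gr ^+ 2 / 2.
  have := budget T'; have := potential_initial.
  have := ler_wpM2l c0 (nzN T'); have := sum_gap0 T'; lra.
have := potential_step l (ltn0Sn T') ST.
by rewrite !(@big_nat_recr _ _ _ T'.+1)//= mulrDr; lra.
Qed.

End trajectory.

(** * The theorem *)

(** Jensen's inequality from the tangent at the average, whose linear terms sum to zero. *)
Lemma convex_function_xavg (R : realType) (n : nat) (X : set 'rV[R]_n)
    (f : 'rV[R]_n -> R) gradf (u : nat -> 'rV[R]_n) T :
  convex_set X -> convex_function X f ->
  (forall z, X z -> has_gradient_at f gradf z) ->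
  (forall t, (1 <= t)%N -> X (u t)) -> (1 <= T)%N ->
  T%:R * f (xavg u T) <= \sum_(1 <= t < T.+1) f (u t).
Proof.
move=> cX cf gf Xu T1.
have T0 : (T%:R : R) != 0 by rewrite pnatr_eq0 -lt0n.
have Xm : X (xavg u T).
  have := convex_set_mean 0%N (index_iota 1 T) cX (fun t => Xu t.+1 isT).
  rewrite (_ : 0%N :: _ = index_iota 0 T); last first.
    by rewrite /index_iota subn0 subn1; case: T T1 {T0}.
  by rewrite size_iota subn0 /xavg big_add1.
have sumc (c : R) : \sum_(1 <= t < T.+1) c = T%:R * c.
  by rewrite sumr_const_nat subn1 mulr_natl.
have h : \sum_(1 <= t < T.+1) dotv (gradf (xavg u T)) (u t - xavg u T) = 0.
  rewrite -dotv_sumr sumrB sumr_const_nat subn1 -scaler_nat /xavg scalerA divff//.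
  by rewrite scale1r subrr dotv0r.
rewrite -subr_ge0 -sumc -sumrB -[leLHS]h; apply: ler_sum_nat => t /andP[t1 _].
exact: (convex_gradient_le cf (gf _ Xm) Xm (Xu t t1)).
Qed.

Lemma sum_prefix_le (R : realType) (c : nat -> R) (N T : nat) :
  (forall t, (1 <= t)%N -> 0 <= c t <= 1) ->
  \sum_(1 <= t < T.+1) (if (t <= N)%N then c t else 0) <= N%:R.
Proof.
move=> c01; apply: (@le_trans _ _ (minn T N)%:R); last by rewrite ler_nat geq_minr.
elim: T => [|T IH]; first by rewrite big_geq.
rewrite big_nat_recr//=; case: ifPn => h.
  have -> : minn T.+1 N = (minn T N).+1 by lia.
  have /andP[_ c1] := c01 T.+1 isT; rewrite -natr1; lra.
by rewrite addr0; apply: le_trans IH _; rewrite ler_nat; lia.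
Qed.

(** The scale [1 / (3 * m)] of the directions cancels the number of agents, leaving partial sums of
    [C2] and [C4] with factors that fit inside [A]. *)
Lemma sum_noise_rate (R : realType) (m : nat) (al la : nat -> R) (p s : R) T :
  (0 < m)%N -> (forall t, (1 <= t)%N -> 0 < la t) ->
  m%:R * s * \sum_(1 <= t < T.+1) @noise_rate R m al la p t =
  s * (2 / 3 * (\sum_(1 <= t < T.+1) al t * la t `^ (1 - p))
       + 2 * (\sum_(1 <= t < T.+1) (al t * la t) ^+ 2 * la t `^ (- p))).
Proof.
move=> m0 la0; have mR : (m%:R : R) != 0 by rewrite pnatr_eq0 -lt0n.
rewrite !mulr_sumr -big_split/= mulr_sumr.
apply: eq_big_nat => t /andP[t1 _]; have l0 := la0 t t1; rewrite /noise_rate.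
have -> : la t `^ (2 - p) = la t ^+ 2 * la t `^ (- p).
  by rewrite powRD ?(gt_eqF l0) ?implybT// powR_mulrn// ltW.
by field.
Qed.

Theorem theorem2 (R : realType) (m n : nat) (X : set 'rV[R]_n)
  (f : 'I_m -> 'rV[R]_n -> R) (gradf : 'I_m -> 'rV[R]_n -> 'rV[R]_n)
  (xstar : 'rV[R]_n)
  (Phi : 'rV[R]_n -> R) (gradPhi : 'rV[R]_n -> 'rV[R]_n)
  (d : measure_display) (Omega : measurableType d) (P : probability Omega R)
  (ghat x y : 'I_m -> nat -> Omega -> 'rV[R]_n) (x1 : 'I_m -> 'rV[R]_n)
  (Pc : nat) (delta p sigma kappa mu gamma L A R1 : R) :
  (* setting *)
  (0 < m)%N -> (0 < Pc)%N ->
  (exists z, X z) -> closed X -> convex_set X ->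
  (forall i, convex_function X (f i)) ->
  (forall i z, X z -> has_gradient_at (f i) (gradf i) z) ->
  X xstar ->
  (forall z, X z -> \sum_(i < m) f i xstar <= \sum_(i < m) f i z) ->
  (forall z, X z -> has_gradient_at Phi gradPhi z) ->
  (forall u v, X u -> X v ->
     Phi u - Phi v >= dotv (gradPhi v) (u - v) + 2^-1 * (enorm (u - v)) ^+ 2) ->
  (* (A1) *)
  (1 < p <= 2) -> 0 < sigma ->
  (forall i t (k : 'I_n), measurable_fun setT (fun w => ghat i t w 0 k)) ->
  (forall i t (k : 'I_n), measurable_fun setT (fun w => x i t w 0 k)) ->
  (forall i t, (1 <= t)%N -> forall S, Fsig ghat t.-1 S ->
     (\int[P]_(w in S) ((enorm (ghat i t w - gradf i (x i t w))) `^ p)%:E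
        <= (sigma `^ p)%:E * P S)%E /\
     (forall k : 'I_n,
        (\int[P]_(w in S) ((ghat i t w - gradf i (x i t w)) 0 k)%:E = 0)%E)) ->
  (* (A2) *)
  0 < L ->
  (forall i u v, X u -> X v ->
     enorm (gradf i u - gradf i v) <= L * enorm (u - v)) ->
  (* (A3) *)
  (forall (k : nat) (a : 'I_k -> R) (ys : 'I_k -> 'rV[R]_n) (z : 'rV[R]_n),
     X z -> (forall j, X (ys j)) -> (forall j, 0 <= a j) -> \sum_(j < k) a j = 1 ->
     bregman Phi gradPhi z (\sum_(j < k) a j *: ys j)
       <= \sum_(j < k) a j * bregman Phi gradPhi z (ys j)) ->
  (* parameters *)
  0 < delta < 1 -> 0 < kappa < 1 -> 0 < mu < 1 ->
  Num.max (mu + 2^-1) (1 - mu * (p - 1)) <= kappa -> 1 < gamma ->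
  (forall i, Num.sqrt (2 * bregman Phi gradPhi xstar (x1 i)) <= R1) ->
  0 < A ->
  A%:E = Aexpr m Pc L delta sigma p
           (alpha gamma kappa mu (Kconst m L R1 A (Bconst gradf x1)))
           (lambda mu (Kconst m L R1 A (Bconst gradf x1))) ->
  (* the Clipped FedSMD iterates *)
  (forall i, X (x1 i)) ->
  (forall i w, x i 1%N w = x1 i) ->
  (forall i t w, (1 <= t)%N ->
     X (y i t.+1 w) /\
     forall z, X z ->
       dotv (clip (lambda mu (Kconst m L R1 A (Bconst gradf x1)) t) (ghat i t w))
            (y i t.+1 w)
       + (alpha gamma kappa mu (Kconst m L R1 A (Bconst gradf x1)) t)^-1
         * bregman Phi gradPhi (y i t.+1 w) (x i t w)
       <= dotv (clip (lambda mu (Kconst m L R1 A (Bconst gradf x1)) t) (ghat i t w)) z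
       + (alpha gamma kappa mu (Kconst m L R1 A (Bconst gradf x1)) t)^-1
         * bregman Phi gradPhi z (x i t w)) ->
  (forall i t w, (1 <= t)%N -> comm_instant Pc t.+1 ->
     x i t.+1 w = (m%:R)^-1 *: \sum_(j < m) y j t.+1 w) ->
  (forall i t w, (1 <= t)%N -> ~ comm_instant Pc t.+1 ->
     x i t.+1 w = y i t.+1 w) ->
  (* conclusion *)
  forall l : 'I_m,
  exists E : set Omega,
    [/\ measurable E, ((1 - delta)%:E <= P E)%E &
      forall w, E w -> forall T : nat, (1 <= T)%N ->
        \sum_(i < m) f i (xavg (fun t => x l t w) T) - \sum_(i < m) f i xstar
        <= (T%:R * alpha gamma kappa mu (Kconst m L R1 A (Bconst gradf x1)) T)^-1
           * ((m%:R) ^+ 2 * (R1 + 10 * A) ^+ 2)].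
Proof.
move=> m0 Pc0 X0 clX cX cf gf Xstar fmin gP sP p12 sigma0 mghat mx A1 L0 gradL A3
  /andP[delta0 delta1] kappa01 /andP[mu0 _] kappa_ge gamma1 R1_ge A0 AE Xx1 x_init
  y_step x_comm x_local l.
set B := Bconst gradf x1 in AE y_step *.
set K := Kconst m L R1 A B in AE y_step *.
set al := alpha gamma kappa mu K in AE y_step *.
set la := lambda mu K in AE y_step *.
set Gr := m%:R * (R1 + 10 * A).
have mR0 : 0 < m%:R :> R by rewrite ltr0n.
have mR1 : 1 <= m%:R :> R by rewrite ler1n.
have R10 : 0 <= R1 by apply: le_trans (R1_ge l); rewrite sqrtr_ge0.
have B0 : 0 <= B by apply: bigmax_ge_id.
have BG i : enorm (gradf i (x1 i)) <= B.
  exact: (@le_bigmax _ _ _ 0 (fun i => enorm (gradf i (x1 i)))).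
have RA0 : 0 < R1 + 10 * A by lra.
have Gr0 : 0 < Gr by rewrite mulr_gt0.
have K0 : 0 < K.
  have h : 0 < m%:R * L * (2 * R1 + 10 * A) by rewrite !mulr_gt0//; lra.
  by rewrite /K /Kconst; lra.
have mukappa : mu <= kappa by move: kappa_ge; rewrite ge_max => /andP[? _]; lra.
have gamma0 : 0 <= gamma by lra.
have al0 t : (1 <= t)%N -> 0 < al t by exact: alpha_gt0.
have la0 t : (1 <= t)%N -> 0 < la t by move=> _; exact: lambda_gt0.
have al_ge0 t : 0 <= al t by exact: alpha_ge0.
have la_ge0 t : 0 <= la t by exact/ltW/lambda_gt0.
have etaE t : (1 <= t)%N -> al t * la t = eta gamma kappa mu t.
  by move=> t1; rewrite /al /la alpha_lambda.
have eta0 t : (1 <= t)%N -> 0 < al t * la t by move=> t1; rewrite mulr_gt0 ?al0 ?la0.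
have eta1' t : (1 <= t)%N -> al t * la t <= 1 by move=> t1; rewrite etaE// eta_le1.
have eta_noninc s t : (1 <= s)%N -> (s <= t)%N -> al t * la t <= al s * la s.
  by move=> s1 st; rewrite !etaE ?(leq_trans s1)//; exact: eta_nonincreasing.
have Xx i t w : (1 <= t)%N -> X (x i t w).
  exact: (iterate_in cX m0 Xx1 x_init y_step x_comm x_local).
have dist1 i : enorm (x1 i - xstar) <= R1.
  by apply: le_trans (R1_ge i); exact: dist_le_sqrt_bregman (sP _ _ Xstar (Xx1 i)).
have grad_small i t z : (1 <= t)%N -> X z -> enorm (z - xstar) <= Gr ->
    enorm (gradf i z) <= la t / 2.
  (* Half of [K] is [L * (Gr + m * R1) + B]: a point of the ball is within [Gr + R1] of [x1 i],
     where the gradient is at most [B]. *)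
  move=> t1 Xz zG.
  have h1 := enormD (gradf i z - gradf i (x1 i)) (gradf i (x1 i)).
  rewrite subrK in h1.
  have h2 := gradL i z (x1 i) Xz (Xx1 i).
  have h3 := enorm_dist xstar z (x1 i).
  have h4 : L * enorm (z - x1 i) <= L * (Gr + m%:R * R1).
    rewrite ler_pM2l//; have := dist1 i; rewrite enormBC.
    have : R1 <= m%:R * R1 by rewrite ler_peMl.
    lra.
  have h5 : K <= la t by exact: lambda_ge.
  have := BG i; rewrite /K /Kconst /Gr in h4 h5 *; lra.
have budget0 T := @Aexpr_ge R m Pc L delta sigma p A al la T L0
  al_ge0 la_ge0 AE.
pose C1 T := \sum_(1 <= t < T.+1) al t * al (tau Pc t) * la t * la (tau Pc t).
pose C2 T := \sum_(1 <= t < T.+1) al t * la t `^ (1 - p).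
pose C4 T := \sum_(1 <= t < T.+1) (al t * la t) ^+ 2 * la t `^ (- p).
have ln0 : 0 <= ln delta^-1 by rewrite ln_ge0// invf_ge1// ltW.
have C20 T : 0 <= sigma `^ p * C2 T.
  by rewrite mulr_ge0 ?powR_ge0// sumr_ge0// => t _; rewrite mulr_ge0 ?powR_ge0.
have C40 T : 0 <= sigma `^ p * C4 T.
  by rewrite mulr_ge0 ?powR_ge0// sumr_ge0// => t _; rewrite mulr_ge0 ?powR_ge0 ?sqr_ge0.
have C10 T : 0 <= m%:R * Pc%:R * C1 T.
  rewrite !mulr_ge0// sumr_ge0// => t _.
  by do 3!apply: mulr_ge0 => //.
have C4m T : 2 * (sigma `^ p * C4 T) <=
    40 * m%:R * sigma `^ p * (1 + 3 * m%:R) * C4 T.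
  rewrite (_ : 40 * _ * _ * _ * _ = (40 * m%:R * (1 + 3 * m%:R)) * (sigma `^ p * C4 T)); last by ring.
  rewrite ler_wpM2r//; nra.
have C1A T : 2 * (m%:R * Pc%:R * C1 T) <= A.
  have := budget0 T; rewrite -/(C1 T) -/(C2 T) -/(C4 T).
  by have := C20 T; have := C40 T; have := C4m T; lra.
have noiseA T : ln delta^-1 + m%:R * sigma `^ p *
    \sum_(1 <= t < T.+1) @noise_rate R m al la p t <= A.
  rewrite sum_noise_rate// -/(C2 T) -/(C4 T).
  have := budget0 T; rewrite -/(C1 T) -/(C2 T) -/(C4 T).
  by have := C10 T; have := C20 T; have := C40 T; have := C4m T; lra.
(* The first term of the series is 1, so [C1A] yields [2 * m * Pc <= A]. This absorbs the error of
   the first period and gives [2 <= A]. *)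
have C11 : C1 1 = 1.
  have tau1 : tau Pc 1 = 1%N by apply/eqP; rewrite eqn_leq tau_le_id ?tau_gt0.
  have e1 : al 1%N * la 1%N = 1 by rewrite etaE// eta1.
  rewrite /C1 big_nat1 tau1 (_ : _ * _ = (al 1%N * la 1%N) * (al 1%N * la 1%N)); last by ring.
  by rewrite e1 mulr1.
have PcA : 2 * (m%:R * Pc%:R) <= A by have := C1A 1%N; rewrite C11 mulr1.
have Pc1 : 1 <= Pc%:R :> R by rewrite ler1n.
have budget T : m%:R * R1 ^+ 2 / 2 + 3 * m%:R * Gr * A + \sum_(1 <= t < T.+1)
    (m%:R / 2 * (al t * la t) ^+ 2
     + m%:R * Pc%:R * (al t * la t * (al (tau Pc t) * la (tau Pc t)))
     + (if (t <= Pc)%N then m%:R * R1 * (al t * la t) else 0)) <= Gr ^+ 2 / 2.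
  rewrite !big_split/=.
  have e1 : \sum_(1 <= t < T.+1) m%:R * Pc%:R *
      (al t * la t * (al (tau Pc t) * la (tau Pc t))) = m%:R * Pc%:R * C1 T.
    by rewrite mulr_sumr; apply: eq_bigr => t _; ring.
  have e2 : \sum_(1 <= t < T.+1) m%:R / 2 * (al t * la t) ^+ 2 <= m%:R * Pc%:R * C1 T / 2.
    rewrite -e1 mulr_suml; apply: ler_sum_nat => t /andP[t1 _].
    have h1 : (al t * la t) ^+ 2 <= al t * la t * (al (tau Pc t) * la (tau Pc t)).
      rewrite expr2 ler_pM2l ?eta0//.
      by apply: eta_noninc; [exact: tau_gt0 | exact: tau_le_id].
    have h2 : m%:R / 2 * (al t * la t) ^+ 2 <= m%:R / 2 * (Pc%:R *
        (al t * la t * (al (tau Pc t) * la (tau Pc t)))).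
      rewrite ler_pM2l ?divr_gt0//; apply: le_trans h1 _.
      rewrite ler_peMl// mulr_ge0 ?(ltW (eta0 _ _))//; exact: tau_gt0.
    lra.
  have e3 : \sum_(1 <= t < T.+1) (if (t <= Pc)%N then m%:R * R1 * (al t * la t) else 0)
      <= m%:R * R1 * Pc%:R.
    rewrite (eq_bigr (fun t => m%:R * R1 * (if (t <= Pc)%N then al t * la t else 0))); last first.
      by move=> t _; case: ifP; rewrite ?mulr0.
    rewrite -mulr_sumr ler_wpM2l ?mulr_ge0//; apply: sum_prefix_le => t t1.
    by rewrite ltW ?eta0// eta1'.
  rewrite e1; have := C1A T.
  have e4 : m%:R * R1 * Pc%:R <= R1 * A / 2.
    have : R1 * (m%:R * Pc%:R) <= R1 * (A / 2) by rewrite ler_wpM2l//; lra.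
    lra.
  have GR : R1 + 10 * A <= Gr by rewrite ler_peMl// ltW.
  have A2 : 2 <= A.
    have : 1 <= m%:R * Pc%:R :> R by rewrite -natrM ler1n muln_gt0 m0.
    lra.
  (* The first summand pays for [m * R1 ^ 2 / 2]. Of the five units [Gr * m * A], the noise takes
     three; the other two are at least [2 * (R1 + 10 * A) * A] and cover the errors, which total at
     most [3 * A / 4 + R1 * A / 2]. *)
  have e5 : Gr ^+ 2 / 2 = Gr * (m%:R * R1) / 2 + 5 * (Gr * (m%:R * A)) by rewrite /Gr; field.
  have e6 : R1 * (m%:R * R1) <= Gr * (m%:R * R1) by rewrite ler_wpM2r ?mulr_ge0//; lra.
  have e7 : (R1 + 10 * A) * A <= Gr * (m%:R * A).
    by rewrite ler_pM// ?(ltW RA0) ?(ltW A0)// ler_peMl// ltW.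
  have e8 : 2 * A <= A * A by rewrite ler_pM2r.
  have e9 : 0 <= R1 * A by rewrite mulr_ge0// ltW.
  lra.
have adx := adapted_iterate (ghat := ghat) X0 cX gP sP m0 al0 Xx1 x_init y_step x_comm x_local.
have [E [mE PE EN]] := noise_bound m0 X0 p12 L0 Gr0 al0 la0 eta1' mghat
  (fun i t k t1 => adx i t k t1) Xx gradL A1
  (fun i t w t1 => grad_small i t _ t1 (Xx i t w t1)) delta0.
exists E; split => // w Ew T T1.
have reg := weighted_regret_le (ghat := fun i t => ghat i t w) (x := fun i t => x i t w)
  (y := fun i t => y i t w) m0 Pc0 cX cf gf Xstar fmin gP sP A3 al0 la0 eta_noninc
  (R1 := R1) (fun i => _) Gr0 grad_small (fun i t => Xx i t w)
  (fun i t => y_step i t w) (fun i t => x_comm i t w) (fun i t => x_local i t w)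
  l T (N := A) _ budget.
have {}reg : \sum_(1 <= t < T.+1) al t * (\sum_i f i (x l t w) - \sum_i f i xstar)
    <= Gr ^+ 2 / 2.
  apply: reg => [i|T']; first by rewrite x_init.
  exact: le_trans (EN w Ew T') (noiseA T').
have aT := al0 T T1; have T0 : 0 < T%:R :> R by rewrite ltr0n.
have h1 : T%:R * (\sum_i f i (xavg (fun t => x l t w) T) - \sum_i f i xstar) <=
    \sum_(1 <= t < T.+1) (\sum_i f i (x l t w) - \sum_i f i xstar).
  rewrite sumrB sumr_const_nat subn1 mulrBr [X in _ - X <= _]mulr_natl lerD2r.
  rewrite mulr_sumr exchange_big/=; apply: ler_sum => i _.
  apply: (convex_function_xavg cX (cf i) (gf i)) => // t t1; exact: Xx.
(* The gaps are nonnegative and the step sizes nonincreasing, so each weight may be lowered to the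
   last one. *)
have h2 : al T * (\sum_(1 <= t < T.+1) (\sum_i f i (x l t w) - \sum_i f i xstar)) <=
    \sum_(1 <= t < T.+1) al t * (\sum_i f i (x l t w) - \sum_i f i xstar).
  rewrite mulr_sumr; apply: ler_sum_nat => t /andP[t1 tT].
  rewrite ler_wpM2r ?subr_ge0 ?fmin//; first exact: Xx.
  exact: (alpha_nonincreasing gamma0 mukappa (ltW mu0) K0 t1 tT).
have z0 : 0 < T%:R * al T by exact: mulr_gt0.
rewrite -exprMn -/Gr ler_pdivlMl//.
have := ler_wpM2l (ltW aT) h1; have := sqr_ge0 Gr.
rewrite mulrCA; lra.
Qed.
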